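(* Let $A$ and $B$ be finite dimensional $k$-algebras, and $F:\mathcal{D}^b(B)\to\mathcal{D}^b(A)$ an essentially surjective eventually homological isomorphism. Then the following statements hold: (1) $A$ is Gorenstein if and only if so is $B$. (2) $A$ satisfies the Gorenstein symmetry conjecture if and only if so does $B$.
   Context: $k$ is a fixed field. $\mathcal{D}^b(A)$ is the bounded derived category of finitely generated left $A$-modules. Eventually homological isomorphism: a triangle functor $F:\mathcal{D}^b(B)\to\mathcal{D}^b(A)$ such that for each pair $Y,Z\in\mathcal{D}^b(B)$ the linear map $\mathrm{Hom}_{\mathcal{D}^b(B)}(Y,Z[i])\to\mathrm{Hom}_{\mathcal{D}^b(A)}(F(Y),F(Z)[i])$ induced by $F$ is an isomorphism for all $i\gg0$. An algebra $A$ is Gorenstein if $A$ has finite injective dimension as a left $A$-module and as a right $A$-module. An algebra $A$ satisfies the Gorenstein symmetry conjecture if: $A$ has finite injective dimension as a left $A$-module if and only if $A$ has finite injective dimension as a right $A$-module. *)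

(* Defs.v *)
From HB Require Import structures.
From mathcomp Require Import all_boot all_order all_algebra.

Set Implicit Arguments.
Unset Strict Implicit.
Unset Printing Implicit Defensive.

Import GRing.Theory.
Local Open Scope ring_scope.

(* A left R-module is an [lmodType R]; a right R-module is an [lmodType R^c],
   where [R^c] is the opposite ring.                                          *)

Section Modules.
Variable R : pzRingType.

Definition fin_gen (M : lmodType R) : Prop :=
  exists (n : nat) (g : 'I_n -> M),
    forall x : M, exists c : 'I_n -> R, x = \sum_(i < n) c i *: g i.

Definition injective_module (I : lmodType R) : Prop :=
  forall (M N : lmodType R) (i : {linear M -> N}) (f : {linear M -> I}),
    injective i -> exists g : {linear N -> I}, forall x, g (i x) = f x.

(* There is an exact sequence 0 -> M -> I 0 -> ... -> I n -> 0 of R-modules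
   with all I j injective; I j is required to vanish for j > n.               *)
Definition finite_injdim (M : lmodType R) : Prop :=
  exists (n : nat) (I : nat -> lmodType R)
         (e : {linear M -> I 0%N}) (d : forall j, {linear I j -> I j.+1}),
    [/\ forall j, injective_module (I j),
        forall j, (n < j)%N -> forall x : I j, x = 0,
        injective e,
        forall x, d 0%N x = 0 <-> exists y, x = e y
      & forall j x, d j.+1 x = 0 <-> exists y, x = d j y].

Lemma fin_gen_prod (M N : lmodType R) :
  fin_gen M -> fin_gen N -> fin_gen (M * N)%type.
Proof.
move=> [m [g gP]] [n [h hP]]; exists (m + n)%N.
exists (fun i => match split i with inl j => (g j, 0) | inr j => (0, h j) end).
move=> [x y]; have [c ->] := gP x; have [e ->] := hP y.
exists (fun i => match split i with inl j => c j | inr j => e j end).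
rewrite big_split_ord /=.
have El i : split (lshift n i) = inl i := unsplitK (inl i).
have Er i : split (rshift m i) = inr i := unsplitK (inr i).
under [X in _ = X + _]eq_bigr => i _ do rewrite El.
under [X in _ = _ + X]eq_bigr => i _ do rewrite Er.
rewrite [RHS]surjective_pairing /= !raddf_sum /=; congr pair.
- by rewrite [X in _ + X]big1 ?addr0 // => i _; rewrite scaler0.
- by rewrite [X in X + _]big1 ?add0r // => i _; rewrite scaler0.
Qed.

End Modules.

(* A k-algebra is a ring with a ring morphism from k into its centre.  Unlike
   [algType k], this does not exclude the zero algebra.                       *)
Record kalgebra (k : fieldType) := KAlgebra {
  kalg_ring :> pzRingType;
  kalg_unit : {rmorphism k -> kalg_ring};
  kalg_central : forall a x, kalg_unit a * x = x * kalg_unit a }.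

Section Gorenstein.
Variables (k : fieldType) (A : kalgebra k).

Definition finite_dimensional : Prop :=
  exists (n : nat) (b : 'I_n -> A),
    forall x : A, exists c : 'I_n -> k,
      x = \sum_(i < n) kalg_unit A (c i) * b i.

Definition finite_left_injdim : Prop := @finite_injdim A A^o.
Definition finite_right_injdim : Prop := @finite_injdim A^c (A^c)^o.

Definition gorenstein : Prop := finite_left_injdim /\ finite_right_injdim.

Definition gorenstein_symmetry : Prop :=
  finite_left_injdim <-> finite_right_injdim.

End Gorenstein.

Section Complexes.
Variables (k : fieldType) (A : kalgebra k).

(* Bounded cochain complexes of finitely generated left A-modules.  As every
   integer has the form n + 1, conditions in degree n + 1 for all n cover all
   degrees.                                                                   *)
Record cpx := Cpx {
  cobj :> int -> lmodType A;
  cdiff : forall n : int, {linear cobj n -> cobj (n + 1)};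
  cdiffK : forall (n : int) x, cdiff (n + 1) (cdiff n x) = 0;
  cobj_fg : forall n : int, fin_gen (cobj n);
  cobj_bounded : exists N : nat, forall n : int,
    (N < absz n)%N -> forall x : cobj n, x = 0 }.

Record cmap (X Y : cpx) := CMap {
  cmap_fun :> forall n : int, {linear X n -> Y n};
  cmap_comm : forall (n : int) x,
    cmap_fun (n + 1) (cdiff X n x) = cdiff Y n (cmap_fun n x) }.

Definition cid (X : cpx) : cmap X X :=
  @CMap X X (fun n => idfun) (fun n x => erefl).

Lemma ccomp_comm (X Y Z : cpx) (g : cmap Y Z) (f : cmap X Y) (n : int) x :
  (g (n + 1) \o f (n + 1)) (cdiff X n x) = cdiff Z n ((g n \o f n) x).
Proof. by rewrite /= !cmap_comm. Qed.

Definition ccomp (X Y Z : cpx) (g : cmap Y Z) (f : cmap X Y) : cmap X Z :=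
  @CMap X Z (fun n => g n \o f n) (ccomp_comm g f).

Lemma czero_comm (X Y : cpx) (n : int) (x : X n) :
  (\0 : {linear X (n + 1) -> Y (n + 1)}) (cdiff X n x)
  = cdiff Y n ((\0 : {linear X n -> Y n}) x).
Proof. by rewrite /= linear0. Qed.

Definition czero (X Y : cpx) : cmap X Y :=
  @CMap X Y (fun n => \0) (@czero_comm X Y).

Lemma cadd_comm (X Y : cpx) (f g : cmap X Y) (n : int) x :
  (f (n + 1) \+ g (n + 1)) (cdiff X n x) = cdiff Y n ((f n \+ g n) x).
Proof. by rewrite /= !cmap_comm linearD. Qed.

Definition cadd (X Y : cpx) (f g : cmap X Y) : cmap X Y :=
  @CMap X Y (fun n => f n \+ g n) (cadd_comm f g).

Section LinScale.
Variables (M N : lmodType A) (a : k) (f : {linear M -> N}).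

Definition lin_scale (x : M) : N := kalg_unit A a *: f x.

Lemma lin_scale_linear : linear lin_scale.
Proof.
by move=> b x y; rewrite /lin_scale linearP scalerDr !scalerA kalg_central.
Qed.

HB.instance Definition _ :=
  GRing.isLinear.Build A M N *:%R lin_scale lin_scale_linear.

End LinScale.

Lemma cscale_comm (X Y : cpx) (a : k) (f : cmap X Y) (n : int) x :
  lin_scale a (f (n + 1)) (cdiff X n x) = cdiff Y n (lin_scale a (f n) x).
Proof. by rewrite /lin_scale cmap_comm linearZ. Qed.

Definition cscale (X Y : cpx) (a : k) (f : cmap X Y) : cmap X Y :=
  @CMap X Y (fun n => lin_scale a (f n)) (cscale_comm a f).

Definition homotopic (X Y : cpx) (f g : cmap X Y) : Prop :=
  exists h : forall n : int, {linear X (n + 1) -> Y n},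
    forall (n : int) x, f (n + 1) x - g (n + 1) x
                = cdiff Y n (h n x) + h (n + 1) (cdiff X (n + 1) x).

(* f induces an injective, resp. surjective, map on cohomology.               *)
Definition qis (X Y : cpx) (f : cmap X Y) : Prop :=
  forall n : int,
    (forall x, cdiff X (n + 1) x = 0 ->
       (exists y, f (n + 1) x = cdiff Y n y) -> exists x', x = cdiff X n x')
    /\ (forall y, cdiff Y (n + 1) y = 0 ->
       exists2 x, cdiff X (n + 1) x = 0
                & exists y', y - f (n + 1) x = cdiff Y n y').

(* X[1]^n = X^(n+1), with differential -d.                         *)
Section Shift.
Variable X : cpx.

Lemma shift_diffK (n : int) (x : X (n + 1)) :
  (\- cdiff X (n + 1 + 1)) ((\- cdiff X (n + 1)) x) = 0.
Proof. by rewrite /= linearN opprK cdiffK. Qed.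

Lemma shift_bounded : exists N : nat, forall n : int,
  (N < absz n)%N -> forall x : X (n + 1), x = 0.
Proof.
have [N NP] := cobj_bounded X; exists N.+1 => n nN; apply: NP.
case: n nN => n nN; first by rewrite -PoszD /= addn1 ltnS ltnW // ltnW.
case: n nN => [|n] //.
rewrite (_ : Negz n.+1 + 1 = Negz n); last by rewrite !NegzE -addn1 PoszD opprD subrK.
by rewrite /= ltnS.
Qed.

Definition shift : cpx :=
  @Cpx (fun n => X (n + 1)) (fun n => \- cdiff X (n + 1)) shift_diffK
       (fun n => cobj_fg X (n + 1)) shift_bounded.

End Shift.

Lemma cshift_comm (X Y : cpx) (f : cmap X Y) (n : int) (x : shift X n) :
  f (n + 1 + 1) (cdiff (shift X) n x) = cdiff (shift Y) n (f (n + 1) x).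
Proof. by rewrite /= linearN cmap_comm. Qed.

Definition cshift (X Y : cpx) (f : cmap X Y) : cmap (shift X) (shift Y) :=
  @CMap (shift X) (shift Y) (fun n => f (n + 1)) (cshift_comm f).

(* cone(f)^n = X^(n+1) * Y^n, with differential (x, y) |-> (-dx, f x + dy).    *)
Section Cone.
Variables (X Y : cpx) (f : cmap X Y).

Definition cone_diff (n : int) (z : X (n + 1)%R * Y n) :
    X (n + 1 + 1)%R * Y (n + 1)%R :=
  (- cdiff X (n + 1) z.1, f (n + 1) z.1 + cdiff Y n z.2).

Lemma cone_diff_linear (n : int) : linear (@cone_diff n).
Proof.
move=> a u v; rewrite /cone_diff /=; congr pair => /=.
- by rewrite linearP opprD scalerN.
- by rewrite !linearP scalerDr addrACA.
Qed.

HB.instance Definition _ (n : int) :=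
  GRing.isLinear.Build A (X (n + 1)%R * Y n)%type (X (n + 1 + 1)%R * Y (n + 1)%R)%type
    *:%R (@cone_diff n) (@cone_diff_linear n).

Lemma cone_diffK (n : int) z : @cone_diff (n + 1) (@cone_diff n z) = 0.
Proof.
rewrite /cone_diff /= linearN opprK cdiffK linearN linearD cdiffK addr0.
by rewrite cmap_comm addNr.
Qed.

Lemma cone_bounded : exists N : nat, forall n : int,
  (N < absz n)%N -> forall x : (X (n + 1)%R * Y n)%type, x = 0.
Proof.
have [N NP] := shift_bounded X; have [M MP] := cobj_bounded Y.
exists (maxn N M) => n; rewrite gtn_max => /andP[nN nM] [x y].
by rewrite (NP n nN x) (MP n nM y).
Qed.

Definition cone : cpx :=
  @Cpx (fun n => (X (n + 1)%R * Y n)%type) (fun n => @cone_diff n) cone_diffK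
       (fun n => fin_gen_prod (cobj_fg X (n + 1)) (cobj_fg Y n)) cone_bounded.

Definition cone_in_fun (n : int) (y : Y n) : cone n := (0, y).

Lemma cone_in_linear (n : int) : linear (@cone_in_fun n).
Proof.
by move=> a u v; rewrite /cone_in_fun; congr pair; rewrite /= scaler0 addr0.
Qed.

HB.instance Definition _ (n : int) :=
  GRing.isLinear.Build A (Y n) (cone n) *:%R (@cone_in_fun n) (@cone_in_linear n).

Lemma cone_in_comm (n : int) y :
  @cone_in_fun (n + 1) (cdiff Y n y) = cdiff cone n (@cone_in_fun n y).
Proof.
by rewrite /cone_in_fun /= /cone_diff /= !linear0 add0r.
Qed.

Definition cone_in : cmap Y cone :=
  @CMap Y cone (fun n => @cone_in_fun n) cone_in_comm.

Lemma cone_out_comm (n : int) z :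
  (cdiff cone n z).1 = cdiff (shift X) n (z.1 : shift X n).
Proof. by []. Qed.

Definition cone_out : cmap cone (shift X) :=
  @CMap cone (shift X)
    (fun n => (@fst (X (n + 1)) (Y n) : {linear (X (n + 1)%R * Y n)%type -> X (n + 1)}))
    cone_out_comm.

End Cone.

Lemma cshift_qis (X Y : cpx) (f : cmap X Y) : qis f -> qis (cshift f).
Proof.
move=> qf n; have [qi qs] := qf (n + 1); split.
- move=> x /= /eqP; rewrite oppr_eq0 => /eqP dx [y fx].
  have [|x' ->] := qi x dx; first by exists (- y); rewrite linearN.
  by exists (- x'); rewrite /= linearN opprK.
- move=> y /= /eqP; rewrite oppr_eq0 => /eqP dy.
  have [x dx [y' e]] := qs y dy; exists x; first by rewrite dx oppr0.
  by exists (- y'); rewrite linearN opprK.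
Qed.

Lemma cshift_homotopic (X Y : cpx) (f g : cmap X Y) :
  homotopic f g -> homotopic (cshift f) (cshift g).
Proof.
case=> h hP; exists (fun n => \- h (n + 1)) => n x /=.
by rewrite hP !linearN /= !opprK.
Qed.

(* D^b(A) is the localisation of the k-linear category K^b(mod A), bounded
   complexes and homotopy classes of chain maps, at the quasi-isomorphisms.  It
   is presented by generators and relations, as a k-linear category: the
   morphisms X -> Y are the expressions [dexpr X Y], built from chain maps and
   formal inverses of quasi-isomorphisms, modulo the congruence [deq].  Since
   quasi-isomorphisms admit a calculus of fractions in K^b(mod A), the usual
   localisation is already k-linear and has the same universal property.
   Hom-spaces are kept as setoids, with [deq] in the role of equality: they
   are not small relative to the universe of modules, hence cannot themselves
   be objects of [lmodType k].                                                *)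
Inductive dexpr : cpx -> cpx -> Type :=
| dmap X Y : cmap X Y -> dexpr X Y
| dinv X Y (s : cmap X Y) : qis s -> dexpr Y X
| dcomp X Y Z : dexpr Y Z -> dexpr X Y -> dexpr X Z
| dadd X Y : dexpr X Y -> dexpr X Y -> dexpr X Y
| dscale X Y : k -> dexpr X Y -> dexpr X Y.

Inductive deq : forall X Y : cpx, dexpr X Y -> dexpr X Y -> Prop :=
| deq_refl X Y (f : dexpr X Y) : deq f f
| deq_sym X Y (f g : dexpr X Y) : deq f g -> deq g f
| deq_trans X Y (f g h : dexpr X Y) : deq f g -> deq g h -> deq f h
| deq_comp X Y Z (g g' : dexpr Y Z) (f f' : dexpr X Y) :
    deq g g' -> deq f f' -> deq (dcomp g f) (dcomp g' f')
| deq_add X Y (f f' g g' : dexpr X Y) :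
    deq f f' -> deq g g' -> deq (dadd f g) (dadd f' g')
| deq_scale X Y a (f f' : dexpr X Y) :
    deq f f' -> deq (dscale a f) (dscale a f')
| deq_compA X Y Z W (h : dexpr Z W) (g : dexpr Y Z) (f : dexpr X Y) :
    deq (dcomp h (dcomp g f)) (dcomp (dcomp h g) f)
| deq_comp1l X Y (f : dexpr X Y) : deq (dcomp (dmap (cid Y)) f) f
| deq_comp1r X Y (f : dexpr X Y) : deq (dcomp f (dmap (cid X))) f
| deq_addA X Y (f g h : dexpr X Y) :
    deq (dadd f (dadd g h)) (dadd (dadd f g) h)
| deq_addC X Y (f g : dexpr X Y) : deq (dadd f g) (dadd g f)
| deq_add0 X Y (f : dexpr X Y) : deq (dadd (dmap (czero X Y)) f) f
| deq_addN X Y (f : dexpr X Y) :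
    deq (dadd (dscale (-1) f) f) (dmap (czero X Y))
| deq_scaleA X Y a b (f : dexpr X Y) :
    deq (dscale a (dscale b f)) (dscale (a * b) f)
| deq_scale1 X Y (f : dexpr X Y) : deq (dscale 1 f) f
| deq_scaleDr X Y a (f g : dexpr X Y) :
    deq (dscale a (dadd f g)) (dadd (dscale a f) (dscale a g))
| deq_scaleDl X Y a b (f : dexpr X Y) :
    deq (dscale (a + b) f) (dadd (dscale a f) (dscale b f))
| deq_compDl X Y Z (g g' : dexpr Y Z) (f : dexpr X Y) :
    deq (dcomp (dadd g g') f) (dadd (dcomp g f) (dcomp g' f))
| deq_compDr X Y Z (g : dexpr Y Z) (f f' : dexpr X Y) :
    deq (dcomp g (dadd f f')) (dadd (dcomp g f) (dcomp g f'))
| deq_compZl X Y Z a (g : dexpr Y Z) (f : dexpr X Y) :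
    deq (dcomp (dscale a g) f) (dscale a (dcomp g f))
| deq_compZr X Y Z a (g : dexpr Y Z) (f : dexpr X Y) :
    deq (dcomp g (dscale a f)) (dscale a (dcomp g f))
| deq_map X Y (f g : cmap X Y) : homotopic f g -> deq (dmap f) (dmap g)
| deq_mapM X Y Z (g : cmap Y Z) (f : cmap X Y) :
    deq (dmap (ccomp g f)) (dcomp (dmap g) (dmap f))
| deq_mapD X Y (f g : cmap X Y) :
    deq (dmap (cadd f g)) (dadd (dmap f) (dmap g))
| deq_mapZ X Y a (f : cmap X Y) : deq (dmap (cscale a f)) (dscale a (dmap f))
| deq_invl X Y (s : cmap X Y) (qs : qis s) :
    deq (dcomp (dinv qs) (dmap s)) (dmap (cid X))
| deq_invr X Y (s : cmap X Y) (qs : qis s) :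
    deq (dcomp (dmap s) (dinv qs)) (dmap (cid Y)).

Definition did (X : cpx) : dexpr X X := dmap (cid X).

Definition diso (X Y : cpx) (f : dexpr X Y) : Prop :=
  exists g : dexpr Y X, deq (dcomp g f) (did X) /\ deq (dcomp f g) (did Y).

Fixpoint dshift (X Y : cpx) (f : dexpr X Y) : dexpr (shift X) (shift Y) :=
  match f in dexpr X0 Y0 return dexpr (shift X0) (shift Y0) with
  | dmap _ _ f => dmap (cshift f)
  | dinv _ _ s qs => dinv (cshift_qis qs)
  | dcomp _ _ _ g f => dcomp (dshift g) (dshift f)
  | dadd _ _ f g => dadd (dshift f) (dshift g)
  | dscale _ _ a f => dscale a (dshift f)
  end.

Lemma cmap_eq_homotopic (X Y : cpx) (f g : cmap X Y) :
  (forall n x, f n x = g n x) -> homotopic f g.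
Proof.
move=> fg; exists (fun n => \0) => n x.
by rewrite fg subrr /= linear0 addr0.
Qed.

Lemma deq_shift (X Y : cpx) (f g : dexpr X Y) :
  deq f g -> deq (dshift f) (dshift g).
Proof.
elim=> {X Y f g} /=; try by [constructor | move=> *; constructor].
- by move=> X Y f g h _ fg _ gh; apply: deq_trans gh.
- move=> X Y f; apply: deq_trans (deq_comp1l _).
  by apply: deq_comp (deq_refl _); apply/deq_map/cmap_eq_homotopic.
- move=> X Y f; apply: deq_trans (deq_comp1r _).
  by apply: deq_comp; [exact: deq_refl | apply/deq_map/cmap_eq_homotopic].
- move=> X Y f; apply: deq_trans (deq_add0 _).
  by apply: deq_add (deq_refl _); apply/deq_map/cmap_eq_homotopic.
- move=> X Y f; apply: deq_trans (deq_addN _) _.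
  by apply/deq_map/cmap_eq_homotopic.
- by move=> X Y f g fg; apply/deq_map/cshift_homotopic.
- move=> X Y Z g f; apply: deq_trans (deq_mapM _ _).
  by apply/deq_map/cmap_eq_homotopic.
- move=> X Y f g; apply: deq_trans (deq_mapD _ _).
  by apply/deq_map/cmap_eq_homotopic.
- move=> X Y a f; apply: deq_trans (deq_mapZ _ _).
  by apply/deq_map/cmap_eq_homotopic.
- move=> X Y s qs; apply: deq_trans (deq_invl _) _.
  by apply/deq_map/cmap_eq_homotopic.
- move=> X Y s qs; apply: deq_trans (deq_invr _) _.
  by apply/deq_map/cmap_eq_homotopic.
Qed.

(* The triangles X -> Y -> Z -> X[1] isomorphic in D^b(A) to
   X' -> Y' -> cone f -> X'[1] for a chain map f : X' -> Y'.                  *)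
Definition distinguished (X Y Z : cpx)
    (u : dexpr X Y) (v : dexpr Y Z) (w : dexpr Z (shift X)) : Prop :=
  exists (X' Y' : cpx) (f : cmap X' Y')
         (a : dexpr X X') (b : dexpr Y Y') (c : dexpr Z (cone f)),
    [/\ diso a, diso b & diso c] /\
    [/\ deq (dcomp b u) (dcomp (dmap f) a),
        deq (dcomp c v) (dcomp (dmap (cone_in f)) b)
      & deq (dcomp (dshift a) w) (dcomp (dmap (cone_out f)) c)].

(* X[i], for i >= 0, is the i-fold iterate of the shift.                      *)
Fixpoint shiftn (i : nat) (X : cpx) : cpx :=
  if i is j.+1 then shift (shiftn j X) else X.

End Complexes.

Section TriangleFunctors.
Variables (k : fieldType) (B A : kalgebra k).

Record triangle_functor := TriangleFunctor {
  tobj :> cpx B -> cpx A;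
  tmap : forall X Y, dexpr X Y -> dexpr (tobj X) (tobj Y);
  tmap_deq : forall X Y (f g : dexpr X Y), deq f g -> deq (tmap f) (tmap g);
  tmap_id : forall X, deq (tmap (did X)) (did (tobj X));
  tmap_comp : forall X Y Z (g : dexpr Y Z) (f : dexpr X Y),
    deq (tmap (dcomp g f)) (dcomp (tmap g) (tmap f));
  tmap_add : forall X Y (f g : dexpr X Y),
    deq (tmap (dadd f g)) (dadd (tmap f) (tmap g));
  tmap_scale : forall X Y a (f : dexpr X Y),
    deq (tmap (dscale a f)) (dscale a (tmap f));
  teta : forall X, dexpr (tobj (shift X)) (shift (tobj X));
  teta_iso : forall X, diso (teta X);
  teta_nat : forall X Y (f : dexpr X Y),
    deq (dcomp (teta Y) (tmap (dshift f))) (dcomp (dshift (tmap f)) (teta X));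
  tmap_distinguished : forall X Y Z
      (u : dexpr X Y) (v : dexpr Y Z) (w : dexpr Z (shift X)),
    distinguished u v w ->
    distinguished (tmap u) (tmap v) (dcomp (teta X) (tmap w)) }.

Variable F : triangle_functor.

(* The isomorphism F(X[i]) -> F(X)[i] obtained by iterating [teta].           *)
Fixpoint tetan (i : nat) (X : cpx B) : dexpr (F (shiftn i X)) (shiftn i (F X)) :=
  match i return dexpr (F (shiftn i X)) (shiftn i (F X)) with
  | 0%N => did (F X)
  | j.+1 => dcomp (dshift (tetan j X)) (teta F (shiftn j X))
  end.

Definition induced_map (Y Z : cpx B) (i : nat) (f : dexpr Y (shiftn i Z)) :
  dexpr (F Y) (shiftn i (F Z)) := dcomp (tetan i Z) (tmap F f).

(* Bijectivity is that of the map on Hom-sets, i.e., modulo [deq].            *)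
Definition eventually_homological_iso : Prop :=
  forall Y Z : cpx B, exists N : nat, forall i : nat, (N <= i)%N ->
    (forall f g : dexpr Y (shiftn i Z),
       deq (induced_map f) (induced_map g) -> deq f g)
    /\ (forall h : dexpr (F Y) (shiftn i (F Z)),
       exists f : dexpr Y (shiftn i Z), deq (induced_map f) h).

Definition essentially_surjective : Prop :=
  forall X : cpx A, exists (Y : cpx B) (f : dexpr (F Y) X), diso f.

End TriangleFunctors.

(* Main.v *)
From HB Require Import structures.
From mathcomp Require Import boolp classical_sets.
Require Import Defs.
From mathcomp Require Import all_boot all_order all_algebra zify.

(** An object [X] of the bounded derived category has finite projective
    dimension when, for every [Y], there are no nonzero morphisms from [X] to
    [Y[i]] for large [i]; it has finite injective dimension when, for every
    [Y], there are none from [Y] to [X[i]].  Both conditions speak only of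
    morphisms to high shifts.  So an eventually homological isomorphism that is
    essentially surjective preserves and reflects them, and with them the
    following two properties of an algebra [A]:
      - (L) objects of finite projective dimension have finite injective
        dimension ([projdim_to_injdim]);
      - (R) objects of finite injective dimension have finite projective
        dimension ([injdim_to_projdim]).
    It remains to see that (L) says that [A] has finite injective dimension on
    the left, and (R) that it has finite injective dimension on the right
    ([left_injdim_iff], [right_injdim_iff]).

    Vector space duality is a contravariant equivalence between the derived
    categories of [A] and of its opposite.  It exchanges the two dimensions, so
    (R) for [A] is (L) for the opposite algebra, and only (L) has to be treated.

    An object of finite projective dimension is isomorphic to a bounded complex
    of finitely generated projectives ([finite_projdim_resolution]): deep in a
    resolution, a syzygy splits off.  If [A] has a finite injective resolution,
    then dimension shifting along it shows that such a complex has finite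
    injective dimension ([projective_finite_injdim]), which is (L).  Conversely,
    (L) applies to [A] itself, as a complex in degree [0].  The dual of [A] is
    then an object of finite projective dimension over the opposite algebra,
    and the dual of its bounded projective resolution is a finite injective
    resolution of [A] ([projdim_to_injdim_left_injdim]).

    Morphisms of the derived category are given by generators and relations.
    They become concrete on a complex [R] that is projective in enough degrees:
    an expression [f] from [X] to [Y] acts on chain maps from [R] to [X] by
    choosing lifts along quasi-isomorphisms ([deval]).  This action computes
    composition with [f] ([deval_sound]) and turns every relation between
    expressions into a homotopy ([deval_deq]).                                *)

Set Implicit Arguments.
Unset Strict Implicit.
Unset Printing Implicit Defensive.

Import Order.TTheory GRing.Theory Num.Theory.
Local Open Scope ring_scope.

(** * Modules *)

(** The dependent version of [choice], for families of linear maps between the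
    modules of two complexes.                                                 *)
Lemma family_choice (I : Type) (T : I -> Type) (P : forall i, T i -> Prop) :
  (forall i, exists x, P i x) -> exists f : forall i, T i, forall i, P i (f i).
Proof.
move=> ex; exists (fun i => sval (constructive_indefinite_description (ex i))) => i.
exact: svalP (constructive_indefinite_description (ex i)).
Qed.

Section LinearRelations.
Variable R : pzRingType.
Implicit Types M N V : lmodType R.

Definition submod M (S : M -> Prop) : Prop :=
  S 0 /\ forall a x y, S x -> S y -> S (a *: x + y).

Definition linrel M N (S : M -> N -> Prop) : Prop :=
  S 0 0 /\ forall a x y v w, S x v -> S y w -> S (a *: x + y) (a *: v + w).

Lemma linear_of_fun M N (f : M -> N) :
  linear f -> exists g : {linear M -> N}, forall x, g x = f x.
Proof.
move=> fl; pose L := GRing.isLinear.Build R M N *:%R f fl.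
by exists (HB.pack_for {linear M -> N} f L).
Qed.

Lemma linear_of_rel M N (S : M -> N -> Prop) : linrel S ->
  (forall x, exists y, S x y) -> (forall y, S 0 y -> y = 0) ->
  exists g : {linear M -> N}, forall x, S x (g x).
Proof.
move=> [S0 SD] tot fun0; have /choice[f fP] := tot.
have uniqS x y z : S x y -> S x z -> y = z.
  move=> xy xz; apply/eqP; rewrite -subr_eq0; apply/eqP/fun0.
  by have := SD (-1) _ _ _ _ xz xy; rewrite !scaleN1r addNr addrC.
have [|g gE] := @linear_of_fun _ _ f.
  move=> a x y; apply: uniqS (fP _) _; exact: SD.
by exists g => x; rewrite gE.
Qed.

(** Lifting through a total linear relation is the same as lifting along a
    surjection, the first projection of the relation.  Relations are what
    exactness provides: [d v = f x] is one between [x] and [v].               *)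
Definition projective (P : lmodType R) : Prop :=
  forall V (S : P -> V -> Prop), linrel S -> (forall x, exists v, S x v) ->
  exists g : {linear P -> V}, forall x, S x (g x).

Definition trivial_mod (M : lmodType R) : Prop := forall x : M, x = 0.

Definition retract M N : Prop :=
  exists (i : {linear M -> N}) (p : {linear N -> M}), forall x, p (i x) = x.

Lemma trivial_eq M (x y : M) : trivial_mod M -> x = y.
Proof. by move=> M0; rewrite (M0 x) (M0 y). Qed.

Lemma trivial_projective M : trivial_mod M -> projective M.
Proof.
move=> M0 V S [S0 _] _; exists \0 => x; by rewrite (M0 x).
Qed.

Lemma retract_projective M N : retract M N -> projective N -> projective M.
Proof.
move=> [i [p pi]] Np V S [S0 SD] tot.
have [||g gP] := Np V (fun x v => S (p x) v).
- split; first by rewrite linear0.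
  by move=> a x y v w Sx Sy; rewrite linearP; apply: SD.
- by move=> x; apply: tot.
exists (g \o i) => x /=; have := gP (i x); by rewrite pi.
Qed.

Definition free_mod m : lmodType R := 'rV[R^o]_m.

Lemma free_projective m : projective (free_mod m).
Proof.
move=> V S [S0 SD] tot.
have /choice[b bP] : forall i : 'I_m, exists v, S (delta_mx 0 i) v.
  by move=> i; apply: tot.
have [|g gE] := @linear_of_fun (free_mod m) V
   (fun x => \sum_i (x 0 i : R) *: b i).
  move=> a x y; rewrite scaler_sumr -big_split; apply: eq_bigr => i _ /=.
  by rewrite !mxE scalerDl scalerA.
exists g => x; rewrite gE {1}(row_sum_delta x).
have Ssum (s : seq 'I_m) : S (\sum_(i <- s) x 0 i *: delta_mx 0 i)
     (\sum_(i <- s) (x 0 i : R) *: b i).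
  elim: s => [|i s IH]; first by rewrite !big_nil.
  by rewrite !big_cons; apply: SD.
exact: Ssum.
Qed.

Lemma free_fin_gen m : fin_gen (free_mod m).
Proof.
exists m, (fun i => delta_mx 0 i) => x; exists (fun i => x 0 i).
exact: row_sum_delta.
Qed.

Lemma fin_gen_cover M : fin_gen M ->
  exists m (p : {linear free_mod m -> M}), forall y, exists x, p x = y.
Proof.
move=> [m [g gP]]; exists m.
have [|p pE] := @linear_of_fun (free_mod m) M
   (fun x => \sum_i (x 0 i : R) *: g i).
  move=> a x y; rewrite scaler_sumr -big_split; apply: eq_bigr => i _ /=.
  by rewrite !mxE scalerDl scalerA.
exists p => y; have [c ->] := gP y; exists (\row_i c i).
by rewrite pE; apply: eq_bigr => i _; rewrite mxE.
Qed.

Lemma fin_gen_img M N (p : {linear M -> N}) : fin_gen M ->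
  (forall y, exists x, p x = y) -> fin_gen N.
Proof.
move=> [m [g gP]] ps; exists m, (fun i => p (g i)) => y.
have [x <-] := ps y; have [c ->] := gP x; exists c.
by rewrite linear_sum; apply: eq_bigr => i _; rewrite linearZ.
Qed.

Lemma regular_fin_gen : fin_gen (R^o : lmodType R).
Proof.
exists 1, (fun _ => 1) => x; exists (fun _ => x).
by rewrite big_ord1; exact: (esym (mulr1 _)).
Qed.

End LinearRelations.

(** Submodules are given by [Prop]-valued predicates, because kernels, images
    and pullbacks of arbitrary modules are not decidable.                     *)
Section SubQuotient.
Variables (R : pzRingType) (M : lmodType R) (S : M -> Prop) (hS : submod S).

Definition in_submod (h : submod S) : {pred M} := fun x => `[< S x >].

Lemma in_submod_closed : GRing.subsemimod_closed (in_submod hS).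
Proof.
have [S0 SD] := hS; split; [split|].
- exact/asboolP.
- move=> x y /asboolP Sx /asboolP Sy; apply/asboolP.
  by rewrite -[x]scale1r; apply: SD.
- move=> a x /asboolP Sx; apply/asboolP.
  by rewrite -[_ *: _]addr0; apply: SD.
Qed.

HB.instance Definition _ :=
  GRing.isSubmodClosed.Build R M (in_submod hS) in_submod_closed.

Definition sub_mod := {x : M | in_submod hS x}.
HB.instance Definition _ := SubChoice.on sub_mod.
HB.instance Definition _ := [SubChoice_isSubLmodule of sub_mod by <:].

(* Opaque, so that simplification does not expose the underlying sigma type. *)
Fact sub_val_key : {f : {linear sub_mod -> M} | forall x, f x = \val x}.
Proof. by exists \val. Qed.
Definition sub_val : {linear sub_mod -> M} := sval sub_val_key.

Lemma sub_valE x : sub_val x = \val x.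
Proof. exact: svalP sub_val_key x. Qed.

Lemma sub_val_inj : injective sub_val.
Proof. by move=> x y; rewrite !sub_valE; apply: val_inj. Qed.

Lemma sub_valP x : S (sub_val x).
Proof. by rewrite sub_valE; have /asboolP := valP x. Qed.

Lemma sub_mk x : S x -> exists y, sub_val y = x.
Proof. by move=> /asboolP Sx; exists (Sub x Sx); rewrite sub_valE. Qed.

End SubQuotient.
Arguments sub_val {R M S hS}.
Arguments sub_val_inj {R M S hS}.
Arguments sub_mk {R M S} hS {x}.

Section Quotient.
Variables (R : pzRingType) (M : lmodType R) (S : M -> Prop) (hS : submod S).

Definition quot_rep (h : submod S) (x : M) : M :=
  choose (fun y => `[< S (x - y) >]) x.

Let S0 : S 0. Proof. by case: hS. Qed.
Let SP a x y : S x -> S y -> S (a *: x + y). Proof. by case: hS => _; apply. Qed.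
Let SN x : S x -> S (- x).
Proof. by move=> Sx; rewrite -[- x]addr0 -scaleN1r; apply: SP. Qed.
Let SD x y : S x -> S y -> S (x + y).
Proof. by move=> Sx Sy; rewrite -[x]scale1r; apply: SP. Qed.

Lemma quot_repP x : S (x - quot_rep hS x).
Proof.
apply/asboolP; apply: (@chooseP M (fun y => `[< S (x - y) >]) x).
by rewrite subrr; apply/asboolP.
Qed.

Lemma quot_rep_eq x y : S (x - y) -> quot_rep hS x = quot_rep hS y.
Proof.
move=> Sxy; rewrite /quot_rep.
rewrite (@eq_choose _ _ (fun z => `[< S (y - z) >])); last first.
  move=> z; apply/asboolP/asboolP => [Sxz|Syz].
  - by move: (SD (SN Sxy) Sxz); rewrite opprB subrKA.
  - by move: (SD Sxy Syz); rewrite subrKA.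
apply: choose_id.
- by apply/asboolP; rewrite -opprB; apply: SN.
- by apply/asboolP; rewrite subrr.
Qed.

(** Cosets are encoded by their chosen representatives. *)
Definition quot_mod := {x : M | quot_rep hS x == x}.
HB.instance Definition _ := SubChoice.on quot_mod.

Lemma quot_rep_idem x : quot_rep hS (quot_rep hS x) == quot_rep hS x.
Proof. by apply/eqP/quot_rep_eq; rewrite -opprB; apply/SN/quot_repP. Qed.

Definition qpi (x : M) : quot_mod := exist _ (quot_rep hS x) (quot_rep_idem x).

Lemma qpi_val (q : quot_mod) : qpi (\val q) = q.
Proof. by apply: val_inj; rewrite /= (eqP (valP q)). Qed.

Lemma qpi_eq x y : qpi x = qpi y <-> S (x - y).
Proof.
split=> [/(congr1 val)/= e|Sxy]; last by apply: val_inj; apply: quot_rep_eq.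
have := SD (quot_repP x) (SN (quot_repP y)).
by rewrite e opprB subrKA.
Qed.

Definition qadd (p q : quot_mod) := qpi (\val p + \val q).
Definition qopp (p : quot_mod) := qpi (- \val p).
Definition qscale a (p : quot_mod) := qpi (a *: \val p).

Let val_qpi x : S (\val (qpi x) - x).
Proof. by rewrite -opprB; apply/SN/quot_repP. Qed.

Lemma qpiD x y : qadd (qpi x) (qpi y) = qpi (x + y).
Proof. by apply/qpi_eq; rewrite opprD addrACA; apply: SD. Qed.
Lemma qpiN x : qopp (qpi x) = qpi (- x).
Proof. by apply/qpi_eq; rewrite -opprD; apply: SN. Qed.
Lemma qpiZ a x : qscale a (qpi x) = qpi (a *: x).
Proof. by apply/qpi_eq; rewrite -scalerBr -[_ *: _]addr0; apply: SP. Qed.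

Lemma qaddA : associative qadd.
Proof.
by move=> p q r; rewrite -(qpi_val p) -(qpi_val q) -(qpi_val r) !qpiD addrA.
Qed.
Lemma qaddC : commutative qadd.
Proof. by move=> p q; rewrite /qadd addrC. Qed.
Lemma qadd0 : left_id (qpi 0) qadd.
Proof. by move=> p; rewrite -(qpi_val p) qpiD add0r. Qed.
Lemma qaddN : left_inverse (qpi 0) qopp qadd.
Proof. by move=> p; rewrite -(qpi_val p) qpiN qpiD addNr. Qed.
HB.instance Definition _ := GRing.isZmodule.Build quot_mod qaddA qaddC qadd0 qaddN.

Lemma qscaleA a b p : qscale a (qscale b p) = qscale (a * b) p.
Proof. by rewrite -(qpi_val p) !qpiZ scalerA. Qed.
Lemma qscale1 : left_id 1 qscale.
Proof. by move=> p; rewrite -(qpi_val p) !qpiZ scale1r. Qed.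
Lemma qscaleDr : right_distributive qscale +%R.
Proof.
move=> a p q; rewrite -(qpi_val p) -(qpi_val q).
by rewrite -[X in qscale _ X]/(qadd _ _) -[RHS]/(qadd _ _) !(qpiD, qpiZ) scalerDr.
Qed.
Lemma qscaleDl p : {morph qscale^~ p : a b / a + b}.
Proof.
move=> a b; rewrite -(qpi_val p) -[RHS]/(qadd _ _) !(qpiD, qpiZ) scalerDl.
by [].
Qed.
HB.instance Definition _ :=
  GRing.Zmodule_isLmodule.Build R quot_mod qscaleA qscale1 qscaleDr qscaleDl.

Lemma quot_exists : exists (Q : lmodType R) (p : {linear M -> Q}),
  (forall q, exists x, p x = q) /\ (forall x, p x = 0 <-> S x).
Proof.
have [|p pE] := @linear_of_fun R M quot_mod qpi.
  by move=> a x y; rewrite -qpiD -qpiZ.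
exists quot_mod, p; split=> [q|x]; first by exists (\val q); rewrite pE qpi_val.
by rewrite pE -[0]/(qpi 0) qpi_eq subr0.
Qed.

End Quotient.

(** * Recursion over the integers and homotopies *)

(** Recursion along the degrees of a bounded complex.  Only finitely many values
    are changed, one at a time by [dfwith], so no element of [D n] is transported
    along an equality between degrees.                                        *)
Section IntegerRecursion.
Variables (D : int -> Type) (G : forall n, D n -> Prop).
Variable Rel : forall n, D n -> D (n + 1) -> Prop.

Lemma int_rec_down (a b : int) (h0 : forall n, D n) :
  (forall n, b <= n -> forall x y, @Rel n x y) -> G (h0 b) ->
  (forall n y, a <= n -> @G (n + 1) y -> exists x, @G n x /\ @Rel n x y) ->
  exists h : forall n, D n, forall n, a <= n -> Rel (h n) (h (n + 1)).
Proof.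
move=> base G0 step.
have main (j : nat) : a <= b - j%:Z -> exists h : forall n, D n,
    G (h (b - j%:Z)) /\ forall n, b - j%:Z <= n -> Rel (h n) (h (n + 1)).
  elim: j => [|j IH] aj.
    exists h0; rewrite subr0; split=> // n bn; exact: base.
  have [|h [hG hR]] := IH; first by lia.
  have e : b - j%:Z = (b - j.+1%:Z) + 1 by lia.
  rewrite e in hG hR.
  have [x [xG xR]] := step _ _ aj hG.
  exists (dfwith h x); split; first by rewrite dfwith_in.
  move=> n jn; have [en|nj] := eqVneq (b - j.+1%:Z) n.
    rewrite -en dfwith_in dfwith_out //; lia.
  rewrite !dfwith_out //; last by lia.
  by apply: hR; lia.
have [ab|ba] := leP a b.
  have [|h [_ hR]] := main `|b - a|%N; first by lia.
  by exists h => n an; apply: hR; lia.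
by exists h0 => n an; apply: base; lia.
Qed.

Lemma int_rec_up (a b : int) (h0 : forall n, D n) :
  (forall n, n < a -> forall x y, @Rel n x y) -> G (h0 a) ->
  (forall n x, a <= n -> @G n x -> exists y, @G (n + 1) y /\ @Rel n x y) ->
  exists h : forall n, D n, forall n, n < b -> Rel (h n) (h (n + 1)).
Proof.
move=> base G0 step.
have main (j : nat) : exists h : forall n, D n,
    G (h (a + j%:Z)) /\ forall n, n < a + j%:Z -> Rel (h n) (h (n + 1)).
  elim: j => [|j [h [hG hR]]].
    exists h0; rewrite addr0; split=> // n bn; exact: base.
  have e : a + j.+1%:Z = (a + j%:Z) + 1 by lia.
  have [|y [yG yR]] := step _ _ _ hG; first by lia.
  rewrite e; exists (dfwith h y); split; first by rewrite dfwith_in.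
  move=> n jn; have [en|nj] := eqVneq (a + j%:Z) n.
    rewrite -en dfwith_in dfwith_out //; lia.
  rewrite !dfwith_out; [|lia|lia].
  by apply: hR; lia.
have [h [_ hR]] := main `|b - a|%N.
by exists h => n nb; apply: hR; lia.
Qed.

End IntegerRecursion.

(** Homotopies and cones provide data in degrees [n + 1]; this recovers degree
    [n], which is [n - 1 + 1] only up to a propositional equality.            *)
Lemma int_unplus (D : int -> Type) (f : forall n, D (n + 1)) :
  exists g : forall n, D n, forall n, g (n + 1) = f n.
Proof.
exists (fun n => eq_rect _ D (f (n - 1)) n (subrK 1 n)) => n.
move: (subrK 1 (n + 1)); have : n + 1 - 1 = n by rewrite addrK.
move: (n + 1 - 1) => m -> e; by rewrite (eq_axiomK e).
Qed.

Section Transport.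
Variables (R : pzRingType) (X : int -> lmodType R).

(** Zero unless [m = n]: being total, it needs no proof of [m = n] in terms. *)
Definition gtr (m n : int) : {linear X m -> X n} :=
  match m =P n with
  | ReflectT e => eq_rect m (fun n => {linear X m -> X n}) idfun n e
  | _ => \0
  end.

Lemma gtr_id n x : gtr n n x = x.
Proof. by rewrite /gtr; case: eqP => // e; rewrite eq_axiomK. Qed.

Lemma gtrK m n : m = n -> forall x, gtr n m (gtr m n x) = x.
Proof. by move=> -> x; rewrite !gtr_id. Qed.

End Transport.

Section Homotopies.
Variables (k : fieldType) (A : kalgebra k).
Implicit Types X Y Z W R C : cpx A.

(** The differential between arbitrary degrees, zero unless [n = m + 1].  It is
    opaque, so that simplification keeps [gdiff] folded.                      *)
Fact gdiff_key X (m n : int) :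
  {d : {linear X m -> X n} | forall x, d x = gtr X (m + 1) n (cdiff X m x)}.
Proof. by exists (gtr X (m + 1) n \o cdiff X m). Qed.

Definition gdiff X (m n : int) : {linear X m -> X n} := sval (gdiff_key X m n).

Lemma gdiff_def X m n x : gdiff X m n x = gtr X (m + 1) n (cdiff X m x).
Proof. exact: svalP (gdiff_key X m n) x. Qed.

Lemma gdiffE X n x : gdiff X n (n + 1) x = cdiff X n x.
Proof. by rewrite gdiff_def gtr_id. Qed.

Lemma gdiffK X m n p (x : X m) : gdiff X n p (gdiff X m n x) = 0.
Proof.
have [e|ne] := eqVneq (m + 1) n.
  by rewrite -e gdiffE gdiff_def cdiffK linear0.
have -> : gdiff X m n x = 0 by rewrite gdiff_def /gtr; case: eqP ne.
by rewrite linear0.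
Qed.

Lemma gdiff_cmap X Y (f : cmap X Y) m n x :
  f n (gdiff X m n x) = gdiff Y m n (f m x).
Proof.
have [e|ne] := eqVneq (m + 1) n; first by rewrite -e !gdiffE cmap_comm.
by rewrite !gdiff_def /gtr; case: eqP ne; rewrite //= linear0.
Qed.

Lemma homotopic_refl X Y (f : cmap X Y) : homotopic f f.
Proof. exact: cmap_eq_homotopic. Qed.

Lemma homotopic_sym X Y (f g : cmap X Y) : homotopic f g -> homotopic g f.
Proof.
move=> [h hP]; exists (fun n => \- h n) => n x /=.
by rewrite -opprB hP opprD linearN.
Qed.

Lemma homotopic_trans X Y (f g h : cmap X Y) :
  homotopic f g -> homotopic g h -> homotopic f h.
Proof.
move=> [s sP] [t tP]; exists (fun n => s n \+ t n) => n x /=.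
by rewrite -(subrKA (g (n + 1) x)) sP tP linearD addrACA.
Qed.

Lemma homotopic_add X Y (f f' g g' : cmap X Y) :
  homotopic f f' -> homotopic g g' -> homotopic (cadd f g) (cadd f' g').
Proof.
move=> [s sP] [t tP]; exists (fun n => s n \+ t n) => n x /=.
by rewrite opprD addrACA sP tP linearD addrACA.
Qed.

Lemma homotopic_scale X Y a (f f' : cmap X Y) :
  homotopic f f' -> homotopic (cscale a f) (cscale a f').
Proof.
move=> [s sP]; exists (fun n => lin_scale a (s n)) => n x.
by rewrite /= /lin_scale -scalerBr sP scalerDr linearZ.
Qed.

Lemma homotopic_compl X Y Z (g : cmap Y Z) (f f' : cmap X Y) :
  homotopic f f' -> homotopic (ccomp g f) (ccomp g f').
Proof.
move=> [s sP]; exists (fun n => g n \o s n) => n x /=.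
by rewrite -linearB sP linearD cmap_comm.
Qed.

Lemma homotopic_compr X Y Z (g g' : cmap Y Z) (f : cmap X Y) :
  homotopic g g' -> homotopic (ccomp g f) (ccomp g' f).
Proof.
move=> [s sP]; exists (fun n => s n \o f (n + 1)) => n x /=.
by rewrite sP cmap_comm.
Qed.

Lemma homotopic_sub X Y (f g : cmap X Y) :
  homotopic (cadd f (cscale (-1) g)) (czero X Y) <-> homotopic f g.
Proof.
have E n x : lin_scale (-1) (g n) x = - g n x.
  by rewrite /lin_scale rmorphN1 scaleN1r.
split=> -[h hP]; exists h => n x; first by rewrite -hP /= E subr0.
by rewrite -hP /= E subr0.
Qed.

Definition acyclic C : Prop :=
  forall (n : int) x, cdiff C (n + 1) x = 0 -> exists y, x = cdiff C n y.

Lemma cone_acyclic X Y (s : cmap X Y) : qis s -> acyclic (cone s).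
Proof.
move=> qs n [x y] /= []; rewrite /cone_diff /= => /eqP; rewrite oppr_eq0 => /eqP dx sx.
have [inj _] := qs (n + 1).
have [||x' ex] := inj x; first by [].
  exists (- y); rewrite linearN; apply/eqP; rewrite -addr_eq0; exact/eqP.
have [_ surj] := qs n.
have [|z dz [w ew]] := surj (y + s (n + 1) x').
  by rewrite linearD -cmap_comm -ex; exact: etrans (addrC _ _) sx.
exists (- x' + z, w); rewrite /= /cone_diff /=.
congr pair; first by rewrite linearD dz addr0 linearN opprK.
rewrite -ew linearD linearN; move: (s _ x') (s _ z) => a b.
by rewrite -addrA (addrC b) subrK addrC addrK.
Qed.

(** The homotopy is built downwards from the top degree of [R], by projectivity
    of [R] and exactness of [C].  Where [R] is no longer projective, [Y] takes
    over: below degree [a] it vanishes, and in degree [a] the defect of the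
    homotopy is a boundary of [C], which [u] sends to a boundary of [Y], that
    is, to zero.                                                              *)
Lemma null_homotopic_proj R C Y (g : cmap R C) (u : cmap C Y) (a : int) :
  (forall n, a < n -> projective (R n)) -> acyclic C ->
  (forall n, n < a -> trivial_mod (Y n)) -> homotopic (ccomp u g) (czero R Y).
Proof.
move=> Rp acC Y0; have [b Rb] := cobj_bounded R.
pose D n := {linear R (n + 1) -> C n}.
pose G n (y : D n) := forall x, cdiff C n (g n x - y (cdiff R n x)) = 0.
pose Rel n (y : D n) (z : D (n + 1)) :=
  forall x, g (n + 1) x = cdiff C n (y x) + z (cdiff R (n + 1) x).
have Rb' n : b%:Z < n -> trivial_mod (R n) by move=> bn; apply: Rb; lia.
have [||| h hP] := @int_rec_down D G Rel a (b%:Z + 1) (fun n => \0).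
- move=> n bn y z x; rewrite (Rb' (n + 1) _ x); last by lia.
  by rewrite !linear0 addr0.
- move=> x; rewrite (Rb' _ _ x); last by lia.
  by rewrite !(linear0, addr0, subr0).
- move=> n y an yG.
  have [|||x xP] := Rp (n + 1) _ (C n) (fun r c =>
      cdiff C n c = g (n + 1) r - y (cdiff R (n + 1) r)).
  + by lia.
  + split; first by rewrite !(linear0, addr0, subr0). 
    by move=> c r r' v v' e e'; rewrite linearP e e' !linearP scalerDr addrACA.
  + by move=> r; have [c ->] := acC _ _ (yG r); exists c.
  have xR : Rel n x y by move=> r; rewrite xP subrK.
  exists x; split=> // r; have := xR (cdiff R n r).
  rewrite cdiffK linear0 addr0 linearB cmap_comm => ->.
  by rewrite subrr.
exists (fun n => u n \o h n) => n x /=; rewrite subr0.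
have [an|na] := leP a n.
  by rewrite (hP n an) linearD cmap_comm.
have [an|na'] := leP a (n + 1); last exact: trivial_eq (Y0 _ na').
have := hP (n + 1) an (cdiff R (n + 1) x).
rewrite cdiffK linear0 addr0 => e.
have [|c ec] := acC n (g (n + 1) x - h (n + 1) (cdiff R (n + 1) x)).
  by rewrite linearB -cmap_comm e subrr.
move/eqP: ec; rewrite subr_eq => /eqP ->.
by rewrite linearD cmap_comm (Y0 n na (u n c)) (Y0 n na (u n _)).
Qed.

(** Here the homotopy is built upwards from the lowest degree of [Y]: in each
    degree the remaining defect kills boundaries, and is extended.            *)
Lemma null_homotopic_ext W Y (f : cmap W Y) :
  (forall n (p : {linear W (n + 1) -> Y (n + 1)}),
     (forall x, p (cdiff W n x) = 0) ->
     exists q : {linear W (n + 1 + 1) -> Y (n + 1)},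
       forall x, p x = q (cdiff W (n + 1) x)) ->
  homotopic f (czero W Y).
Proof.
move=> ext; have [b Yb] := cobj_bounded Y.
have Y1 n : n < - b%:Z -> trivial_mod (Y n) by move=> bn; apply: Yb; lia.
have Y2 n : b%:Z < n -> trivial_mod (Y n) by move=> bn; apply: Yb; lia.
pose D n := {linear W (n + 1) -> Y n}.
pose G n (y : D n) := forall x, cdiff Y n (f n x - y (cdiff W n x)) = 0.
pose Rel n (y : D n) (z : D (n + 1)) :=
  forall x, f (n + 1) x = cdiff Y n (y x) + z (cdiff W (n + 1) x).
have [||| h hP] := @int_rec_up D G Rel (- b%:Z - 2) b%:Z (fun n => \0).
- by move=> n nb y z x; apply/trivial_eq/Y1; lia.
- by move=> x; apply: Y1; lia.
- move=> n y _ yG.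
  have [|z zP] := ext n (f (n + 1) \- (cdiff Y n \o y)).
    by move=> x /=; rewrite cmap_comm -linearB.
  have R1 : Rel n y z by move=> x; rewrite -zP /= addrCA subrr addr0.
  by exists z; split=> // x; rewrite R1 addrK cdiffK.
exists h => n x /=; rewrite subr0.
have [nb|bn] := ltP n b%:Z; first exact: hP.
by apply/trivial_eq/Y2; lia.
Qed.

(** A homotopy from [q r] to [0] extends [q] to the cone of [r], which is
    acyclic, so that [q] dies on the way through the cone.                    *)
Lemma null_homotopic_desc R' R Y (r : cmap R' R) (q : cmap R Y) (a : int) :
  qis r -> (forall n, a < n -> projective (R n)) ->
  (forall n, n < a -> trivial_mod (Y n)) ->
  homotopic (ccomp q r) (czero R' Y) -> homotopic q (czero R Y).
Proof.
move=> qr Rp Y0 [h hP].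
have /family_choice[u uP] : forall n, exists u : {linear cone r n -> Y n},
    forall z, u z = h n z.1 + q n z.2.
  move=> n; apply: (@linear_of_fun _ (cone r n) (Y n)
    (fun z : cone r n => h n z.1 + q n z.2)).
  by move=> c x y; rewrite !linearP scalerDr addrACA.
have uC n z : u (n + 1) (cdiff (cone r) n z) = cdiff Y n (u n z).
  rewrite !uP /= !linearD cmap_comm linearN addrA; congr (_ + _).
  by have := hP n z.1; rewrite /= subr0 => ->; rewrite addrC addrK.
apply: homotopic_trans (null_homotopic_proj (cone_in r) (CMap uC) Rp (cone_acyclic qr) Y0).
by apply: cmap_eq_homotopic => n x; rewrite /= uP /= linear0 add0r.
Qed.

(** The composite of [p] with [Y -> cone s] is null-homotopic; the two components
    of the homotopy are the lift [q] and the homotopy from [s q] to [p].      *)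
Lemma lift_qis R X Y (s : cmap X Y) (p : cmap R Y) (a : int) :
  qis s -> (forall n, a < n -> projective (R n)) ->
  (forall n, n <= a -> trivial_mod (X n)) ->
  (forall n, n < a -> trivial_mod (Y n)) ->
  exists q : cmap R X, homotopic (ccomp s q) p.
Proof.
move=> qs Rp X0 Y0.
have [|h hP] := null_homotopic_proj (ccomp (cone_in s) p) (cid (cone s)) Rp (cone_acyclic qs).
  by move=> n na [x y]; rewrite (X0 (n + 1) _ x) ?(Y0 n _ y) //; lia.
have hP1 n x : (h (n + 1) (cdiff R (n + 1) x)).1 = cdiff X (n + 1) (h n x).1.
  have /(congr1 fst) := hP n x; rewrite subr0 /= => /esym/eqP.
  by rewrite addr_eq0 eqr_opp => /eqP.
have hP2 n x : p (n + 1) x = (s (n + 1) (h n x).1 + cdiff Y n (h n x).2) +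
    (h (n + 1) (cdiff R (n + 1) x)).2.
  by have /(congr1 snd) := hP n x; rewrite subr0.
have [q qP] := @int_unplus (fun n => {linear R n -> X n}) (fun n => fst \o h n).
have qC n x : q (n + 1) (cdiff R n x) = cdiff X n (q n x).
  move: x; rewrite -(subrK 1 n) => x; rewrite !qP /=.
  exact: hP1.
exists (CMap qC); exists (fun n => \- (snd \o h n)) => n x /=.
by rewrite hP2 qP /= linearN -addrA opprD addNKr opprD.
Qed.

(** For [u = q - q'], a homotopy from [s u] to [0] completes [u] to a chain map
    from the shift of [R] to [cone s]; the first component of a null-homotopy of
    the latter is one of [u].                                                 *)
Lemma lift_qis_uniq R X Y (s : cmap X Y) (q q' : cmap R X) (a : int) :
  qis s -> (forall n, a < n -> projective (R n)) ->
  (forall n, n < a -> trivial_mod (X n)) ->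
  (forall n, n + 1 < a -> trivial_mod (Y n)) ->
  homotopic (ccomp s q) (ccomp s q') -> homotopic q q'.
Proof.
move=> qs Rp X0 Y0 sqq; apply/homotopic_sub.
have : homotopic (ccomp s (cadd q (cscale (-1) q'))) (czero R Y).
  apply: homotopic_trans ((homotopic_sub _ _).2 sqq).
  by apply: cmap_eq_homotopic => n x; rewrite /= linearD /lin_scale linearZ.
move: (cadd _ _) => u [h hP].
have /family_choice[g gP] : forall n, exists g : {linear shift R n -> cone s n},
    forall x, g x = (u (n + 1) x, - h n x).
  move=> n; apply: (@linear_of_fun _ (shift R n) (cone s n)
    (fun x => (u (n + 1) x, - h n x))) => c x y.
  by rewrite !linearP.
have gC n x : g (n + 1) (cdiff (shift R) n x) = cdiff (cone s) n (g n x).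
  rewrite !gP /= /cone_diff /= !linearN opprK !cmap_comm; congr pair.
  by have := hP n x; rewrite /= subr0 => ->; rewrite (addrC (cdiff Y n _)) addrK.
have [||e eP] := null_homotopic_proj (CMap gC) (cid (cone s)) _ (cone_acyclic qs) (a := a - 1).
- by move=> n an; apply: Rp; lia.
- by move=> n na [x y]; rewrite (X0 (n + 1) _ x) ?(Y0 n _ y) //; lia.
have [t tP] := @int_unplus (fun n => {linear R (n + 1) -> X n}) (fun n => \- (fst \o e n)).
exists t => n x; move: x; rewrite -(subrK 1 n) => x.
have /(congr1 fst) := eP (n - 1) x; rewrite /= gP /= !subr0 => ->.
by rewrite !tP /= !linearN.
Qed.

End Homotopies.

(** * Morphisms of the derived category as chain maps *)

Section Evaluation.
Variables (k : fieldType) (A : kalgebra k).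
Implicit Types X Y Z W R C : cpx A.

Definition proj_above (a : int) R : Prop := forall n, a < n -> projective (R n).

(** How far down [R] has to be projective depends on the expressions of the
    derived category, and on the derivations of relations, at hand.           *)
Definition eventually_proj (P : cpx A -> Prop) : Prop :=
  exists a, forall R, proj_above a R -> P R.

Lemma eventually_proj_and (P Q : cpx A -> Prop) :
  eventually_proj P -> eventually_proj Q -> eventually_proj (fun R => P R /\ Q R).
Proof.
move=> [a aP] [b bQ]; exists (Num.min a b) => R Rab; split.
- by apply: aP => n an; apply: Rab; lia.
- by apply: bQ => n an; apply: Rab; lia.
Qed.

Lemma eventually_proj_sub (P Q : cpx A -> Prop) :
  (forall R, P R -> Q R) -> eventually_proj P -> eventually_proj Q.
Proof. by move=> PQ [a aP]; exists a => R /aP/PQ. Qed.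

Lemma eventually_projT (P : cpx A -> Prop) : (forall R, P R) -> eventually_proj P.
Proof. by move=> PP; exists 0. Qed.

Definition qlift R X Y (s : cmap X Y) (p : cmap R Y) : cmap R X :=
  if pselect (exists q : cmap R X, homotopic (ccomp s q) p) is left e
  then sval (constructive_indefinite_description e) else czero R X.

(** When [R] is projective in enough degrees, its morphisms to [X] in the derived
    category are the homotopy classes of chain maps, and [deval f] is then
    composition with [f].                                                     *)
Fixpoint deval R X Y (f : dexpr X Y) : cmap R X -> cmap R Y :=
  match f in dexpr X0 Y0 return cmap R X0 -> cmap R Y0 with
  | dmap _ _ f => fun p => ccomp f p
  | dinv _ _ s _ => fun p => qlift s p
  | dcomp _ _ _ g f => fun p => deval g (deval f p)
  | dadd _ _ f g => fun p => cadd (deval f p) (deval g p)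
  | dscale _ _ a f => fun p => cscale a (deval f p)
  end.

Definition unique_lifts R X Y (s : cmap X Y) : Prop :=
  (forall p : cmap R Y, homotopic (ccomp s (qlift s p)) p) /\
  (forall q q' : cmap R X, homotopic (ccomp s q) (ccomp s q') -> homotopic q q').

Fixpoint deval_ok R X Y (f : dexpr X Y) : Prop :=
  match f with
  | dmap _ _ _ => True
  | dinv _ _ s _ => unique_lifts R s
  | dcomp _ _ _ g f => deval_ok R g /\ deval_ok R f
  | dadd _ _ f g => deval_ok R f /\ deval_ok R g
  | dscale _ _ _ f => deval_ok R f
  end.

Lemma deval_okP X Y (f : dexpr X Y) : eventually_proj (fun R => deval_ok R f).
Proof.
elim: X Y / f => [X Y f|X Y s qs|X Y Z g gP f fP|X Y f fP g gP|X Y a f fP] /=.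
- exact: eventually_projT.
- have [b Xb] := cobj_bounded X; have [c Yc] := cobj_bounded Y.
  (* below the supports of X and Y *)
  exists (- (maxn b c)%:Z - 2) => R Rp; split=> [p|q q'].
  + rewrite /qlift; case: pselect => [e|[]]; first exact: svalP (constructive_indefinite_description e).
    apply: lift_qis qs Rp _ _ => n na; [apply: Xb|apply: Yc]; lia.
  + apply: lift_qis_uniq qs Rp _ _ => n na; [apply: Xb|apply: Yc]; lia.
- exact: eventually_proj_and.
- exact: eventually_proj_and.
- by [].
Qed.

Lemma deval_homotopic R X Y (f : dexpr X Y) (p p' : cmap R X) :
  deval_ok R f -> homotopic p p' -> homotopic (deval f p) (deval f p').
Proof.
elim: X Y / f p p' => [X Y f|X Y s qs|X Y Z g gP f fP|X Y f fP g gP|X Y a f fP] p p' /=.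
- by move=> _; apply: homotopic_compl.
- move=> [ex uniq] pp; apply: uniq; apply: homotopic_trans (ex _) _.
  exact: homotopic_trans pp (homotopic_sym (ex _)).
- by move=> [okg okf] pp; apply: gP => //; apply: fP.
- by move=> [okf okg] pp; apply: homotopic_add; [apply: fP|apply: gP].
- by move=> ok pp; apply: homotopic_scale; apply: fP.
Qed.

Lemma deval_add R X Y (f : dexpr X Y) (p p' : cmap R X) : deval_ok R f ->
  homotopic (deval f (cadd p p')) (cadd (deval f p) (deval f p')).
Proof.
elim: X Y / f p p' => [X Y f|X Y s qs|X Y Z g gP f fP|X Y f fP g gP|X Y a f fP] p p' /=.
- by move=> _; apply: cmap_eq_homotopic => n x; rewrite /= linearD.
- move=> [ex uniq]; apply: uniq; apply: homotopic_trans (ex _) _.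
  apply: homotopic_sym.
  apply: homotopic_trans (homotopic_add (ex p) (ex p')).
  by apply: cmap_eq_homotopic => n x; rewrite /= linearD.
- move=> [okg okf]; apply: homotopic_trans (gP _ _ okg).
  by apply: deval_homotopic => //; apply: fP.
- move=> [okf okg]; apply: homotopic_trans (homotopic_add (fP _ _ okf) (gP _ _ okg)) _.
  by apply: cmap_eq_homotopic => n x; rewrite /= addrACA.
- move=> ok; apply: homotopic_trans (homotopic_scale _ (fP _ _ ok)) _.
  by apply: cmap_eq_homotopic => n x; rewrite /= /lin_scale scalerDr.
Qed.

Lemma deval_scale R X Y (f : dexpr X Y) b (p : cmap R X) : deval_ok R f ->
  homotopic (deval f (cscale b p)) (cscale b (deval f p)).
Proof.
elim: X Y / f p => [X Y f|X Y s qs|X Y Z g gP f fP|X Y f fP g gP|X Y a f fP] p /=.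
- by move=> _; apply: cmap_eq_homotopic => n x; rewrite /= /lin_scale linearZ.
- move=> [ex uniq]; apply: uniq; apply: homotopic_trans (ex _) _.
  apply: homotopic_sym.
  apply: homotopic_trans (homotopic_scale b (ex p)).
  by apply: cmap_eq_homotopic => n x; rewrite /= /lin_scale linearZ.
- move=> [okg okf]; apply: homotopic_trans (gP _ okg).
  by apply: deval_homotopic => //; apply: fP.
- move=> [okf okg]; apply: homotopic_trans (homotopic_add (fP _ okf) (gP _ okg)) _.
  by apply: cmap_eq_homotopic => n x; rewrite /= /lin_scale scalerDr.
- move=> ok; apply: homotopic_trans (homotopic_scale _ (fP _ ok)) _.
  apply: cmap_eq_homotopic => n x; rewrite /= /lin_scale !scalerA.
  by rewrite -!rmorphM mulrC.
Qed.

Lemma deval_sound R X Y (f : dexpr X Y) (p : cmap R X) : deval_ok R f ->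
  deq (dcomp f (dmap p)) (dmap (deval f p)).
Proof.
elim: X Y / f p => [X Y f|X Y s qs|X Y Z g gP f fP|X Y f fP g gP|X Y a f fP] p /=.
- by move=> _; apply: deq_sym; apply: deq_mapM.
- move=> [ex _].
  apply: deq_trans (deq_comp (deq_refl (dinv qs)) (deq_sym (deq_map (ex p)))) _.
  apply: deq_trans (deq_comp (deq_refl _) (deq_mapM _ _)) _.
  apply: deq_trans (deq_compA _ _ _) _.
  apply: deq_trans (deq_comp (deq_invl qs) (deq_refl _)) _.
  exact: deq_comp1l.
- move=> [okg okf]; apply: deq_trans (deq_sym (deq_compA _ _ _)) _.
  apply: deq_trans (deq_comp (deq_refl _) (fP _ okf)) _.
  exact: gP.
- move=> [okf okg]; apply: deq_trans (deq_compDl _ _ _) _.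
  apply: deq_trans (deq_add (fP _ okf) (gP _ okg)) _.
  exact/deq_sym/deq_mapD.
- move=> ok; apply: deq_trans (deq_compZl _ _ _) _.
  apply: deq_trans (deq_scale _ (fP _ ok)) _.
  exact/deq_sym/deq_mapZ.
Qed.

(** The bound depends on the derivation of [deq f g], because [R] has to be
    projective enough for the intermediate objects of the derivation.         *)
Lemma deval_deq X Y (f g : dexpr X Y) : deq f g ->
  eventually_proj (fun R => forall p : cmap R X, homotopic (deval f p) (deval g p)).
Proof.
elim=> {X Y f g} /=.
- by move=> X Y f; apply: eventually_projT => R p; apply: homotopic_refl.
- move=> X Y f g _; apply: eventually_proj_sub => R fg p; exact: homotopic_sym.
- move=> X Y f g h _ fg _ gh; have := eventually_proj_and fg gh.
  by apply: eventually_proj_sub => R [fgR ghR] p; apply: homotopic_trans (ghR p).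
- move=> X Y Z g g' f f' _ gg _ ff.
  have := eventually_proj_and (eventually_proj_and gg ff) (deval_okP g).
  apply: eventually_proj_sub => R [[ggR ffR] ok] p.
  by apply: homotopic_trans (ggR _); apply: deval_homotopic.
- move=> X Y f f' g g' _ ff _ gg; have := eventually_proj_and ff gg.
  by apply: eventually_proj_sub => R [ffR ggR] p; apply: homotopic_add.
- move=> X Y a f f' _; apply: eventually_proj_sub => R ffR p.
  exact: homotopic_scale.
- by move=> X Y Z W h g f; apply: eventually_projT => R p; apply: homotopic_refl.
- by move=> X Y f; apply: eventually_projT => R p; apply: cmap_eq_homotopic.
- move=> X Y f; apply: eventually_proj_sub (deval_okP f) => R ok p.
  by apply: deval_homotopic => //; apply: cmap_eq_homotopic.
- move=> X Y f g h; apply: eventually_projT => R p.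
  by apply: cmap_eq_homotopic => n x; rewrite /= addrA.
- move=> X Y f g; apply: eventually_projT => R p.
  by apply: cmap_eq_homotopic => n x; rewrite /= addrC.
- move=> X Y f; apply: eventually_projT => R p.
  by apply: cmap_eq_homotopic => n x; rewrite /= add0r.
- move=> X Y f; apply: eventually_projT => R p.
  apply: cmap_eq_homotopic => n x.
  by rewrite /= /lin_scale rmorphN1 scaleN1r addNr.
- move=> X Y a b f; apply: eventually_projT => R p.
  by apply: cmap_eq_homotopic => n x; rewrite /= /lin_scale scalerA rmorphM.
- move=> X Y f; apply: eventually_projT => R p.
  by apply: cmap_eq_homotopic => n x; rewrite /= /lin_scale rmorph1 scale1r.
- move=> X Y a f g; apply: eventually_projT => R p.
  by apply: cmap_eq_homotopic => n x; rewrite /= /lin_scale scalerDr.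
- move=> X Y a b f; apply: eventually_projT => R p.
  by apply: cmap_eq_homotopic => n x; rewrite /= /lin_scale rmorphD scalerDl.
- by move=> X Y Z g g' f; apply: eventually_projT => R p; apply: homotopic_refl.
- move=> X Y Z g f f'; apply: eventually_proj_sub (deval_okP g) => R ok p.
  exact: deval_add.
- by move=> X Y Z a g f; apply: eventually_projT => R p; apply: homotopic_refl.
- move=> X Y Z a g f; apply: eventually_proj_sub (deval_okP g) => R ok p.
  exact: deval_scale.
- by move=> X Y f g fg; apply: eventually_projT => R p; apply: homotopic_compr.
- by move=> X Y Z g f; apply: eventually_projT => R p; apply: cmap_eq_homotopic.
- by move=> X Y f g; apply: eventually_projT => R p; apply: cmap_eq_homotopic.
- by move=> X Y a f; apply: eventually_projT => R p; apply: cmap_eq_homotopic.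
- move=> X Y s qs; apply: eventually_proj_sub (deval_okP (dinv qs)) => R [ex uniq] p.
  by apply: uniq; apply: homotopic_trans (ex _) _; apply: cmap_eq_homotopic.
- move=> X Y s qs; apply: eventually_proj_sub (deval_okP (dinv qs)) => R [ex uniq] p.
  by apply: homotopic_trans (ex _) _; apply: cmap_eq_homotopic.
Qed.

End Evaluation.

(** * Projective resolutions *)

Definition noetherian (R : pzRingType) : Prop :=
  forall (M : lmodType R) (S : M -> Prop) (hS : submod S),
    fin_gen M -> fin_gen (sub_mod hS).

Lemma retract_trivial (R : pzRingType) (M N : lmodType R) :
  retract M N -> trivial_mod N -> trivial_mod M.
Proof. by move=> [i [p pi]] N0 x; rewrite -(pi x) (N0 (i x)) linear0. Qed.

Section Resolution.
Variables (k : fieldType) (A : kalgebra k).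
Hypothesis noethA : noetherian A.
Implicit Types X Y Z W R C : cpx A.

Lemma qis_id X : qis (cid X).
Proof.
move=> n; split=> [x _ [y]|y dy]; first by exists y.
by exists y => //; exists 0; rewrite subrr linear0.
Qed.

Lemma qis_comp X Y Z (g : cmap Y Z) (f : cmap X Y) :
  qis g -> qis f -> qis (ccomp g f).
Proof.
move=> qg qf n; have [gi gs] := qg n; have [fi fs] := qf n; split=> [x dx|z dz].
  move=> /= /gi-/(_ _)[|y ey]; first by rewrite -cmap_comm dx linear0.
  by apply: fi => //; exists y.
have [y dy [w ew]] := gs z dz; have [x dx [v ev]] := fs y dy.
exists x => //; exists (w + g n v) => /=.
by rewrite linearD -cmap_comm -ev -ew linearB addrA subrK.
Qed.

Section Step.
Variables (X : cpx A) (n : int) (P : lmodType A) (p : {linear P -> X n}).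
Hypotheses (P_proj : projective P) (P_fg : fin_gen P).
Hypothesis p_surj : forall y, exists x, p x = y.

(** The submodule of [X m * P] that is [P] for [m = n], the pullback of [P] along
    the differential for [m = n - 1], and [X m] otherwise.  Cutting all degrees
    out of the same kind of product avoids modules defined by cases on [m].   *)
Definition step_mem (m : int) (z : X m * P) : Prop :=
  [/\ m = n -> gtr X m n z.1 = p z.2,
      m + 1 = n -> gdiff X m n z.1 = p z.2
    & m <> n -> m + 1 <> n -> z.2 = 0].

Lemma step_submod m : submod (@step_mem m).
Proof.
split; first by split=> //=; rewrite !linear0.
move=> a [x1 x2] [y1 y2] [/= hx1 hx2 hx3] [/= hy1 hy2 hy3]; split=> /=.
- by move=> e; rewrite !linearP hx1 // hy1.
- by move=> e; rewrite !linearP hx2 // hy2.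
- by move=> e e'; rewrite hx3 // hy3 // scaler0 addr0.
Qed.

Notation stepX m := (sub_mod (step_submod m)).

Lemma step_diff m : exists d : {linear stepX m -> stepX (m + 1)},
  forall z, sub_val (d z) = (cdiff X m (sub_val z).1,
                             if m + 1 == n then (sub_val z).2 else 0).
Proof.
apply: (@linear_of_rel _ _ _ (fun (z : stepX m) (w : stepX (m + 1)) => sub_val w =
   (cdiff X m (sub_val z).1, if m + 1 == n then (sub_val z).2 else 0))).
- split; first by rewrite !linear0; case: ifP.
  move=> a z z' w w' e e'; rewrite linearP e e' !linearP; congr pair => /=.
  by case: ifP => // _; rewrite scaler0 addr0.
- move=> z; have [z1 z2 z3] := sub_valP z.
  set w := (_, _); have [|y yw] := @sub_mk _ _ _ (step_submod (m + 1)) w; last by exists y.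
  rewrite /w; split=> /= e; first by rewrite ifT -?gdiff_def; [exact: z2|exact/eqP].
  + rewrite ifF; last by lia.
    by rewrite linear0 gdiff_def cdiffK linear0.
  + by move=> _; rewrite ifF //; exact/eqP.
- move=> y; rewrite !linear0 => e; apply: (@sub_val_inj _ _ _ (step_submod (m + 1))).
  by rewrite e linear0; case: ifP.
Qed.

(** The kernel of [X' -> X] is [ker p] in degrees [n - 1] and [n], joined by the
    identity, hence acyclic.                                                  *)
Lemma resolution_step : exists (X' : cpx A) (r : cmap X' X),
  [/\ qis r, projective (X' n)
    & forall m, m <> n -> m + 1 <> n -> retract (X' m) (X m)].
Proof.
have /family_choice[d dE] := step_diff.
have dK (m : int) z : d (m + 1) (d m z) = 0.
  apply: sub_val_inj; rewrite !dE linear0 /= cdiffK; congr pair.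
  by case: eqP => // e1; rewrite ifF //; lia.
have fg m : fin_gen (stepX m).
  by apply: noethA; apply: fin_gen_prod => //; exact: cobj_fg.
have [N XN] := cobj_bounded X.
have bd : exists N : nat, forall m : int, (N < absz m)%N -> forall x : stepX m, x = 0.
  exists (N + absz n + 1)%N => m Nm z; apply: sub_val_inj; rewrite linear0.
  have [_ _ z2] := sub_valP z; rewrite [sub_val z]surjective_pairing.
  by rewrite z2 ?(XN m _ (sub_val z).1) //; lia.
pose X' := @Cpx k A (fun m => stepX m) d dK fg bd.
have rC m (z : X' m) : (fst \o @sub_val _ _ _ (step_submod (m + 1))) (cdiff X' m z) =
    cdiff X m ((fst \o @sub_val _ _ _ (step_submod m)) z). by rewrite /= dE.
exists X', (CMap rC); split.
- move=> m; split.
  + move=> /= z dz [y zy]; have [z1 z2 z3] := sub_valP z.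
    have dz0 := congr1 (@sub_val _ _ _ (step_submod _)) dz.
    rewrite dE linear0 in dz0; case: dz0 => dz1 dz2.
    (* the P-component of a preimage of z *)
    suff [q [q1 q2]] : exists q, step_mem (y, q) /\
        (if m + 1 == n then q else 0) = (sub_val z).2.
      have [w wE] := sub_mk (step_submod m) q1; exists w; apply: sub_val_inj.
      by rewrite dE wE /= -zy q2 -surjective_pairing.
    have [e|ne] := eqVneq (m + 1) n.
      exists (sub_val z).2; split=> //; split=> /= [e'|_|_ []//]; first by lia.
      by rewrite -z1 // gdiff_def zy.
    have z20 : (sub_val z).2 = 0.
      have [e|/eqP ne'] := eqVneq (m + 1 + 1) n; first by move: dz2; rewrite e eqxx.
      by apply: z3 => //; exact/eqP.
    have [e|/eqP ne'] := eqVneq m n.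
      have [q qP] := p_surj (gtr X m n y); exists q.
      split; first by split=> //= e'; lia.
      by rewrite z20.
    exists 0; split; last by rewrite z20.
    by split=> //= e'; lia.
  + move=> y dy.
    have [q [q1 q2]] : exists q, step_mem (y, q) /\
        (if m + 1 + 1 == n then q else 0) = 0.
      have [e|/eqP ne] := eqVneq (m + 1) n.
        have [q qP] := p_surj (gtr X (m + 1) n y); exists q; split; last by rewrite ifF //; lia.
        by split=> //= e'; lia.
      exists 0; split; last by case: ifP.
      by split=> //= e; rewrite linear0 gdiff_def dy linear0.
    have [w wE] := sub_mk (step_submod (m + 1)) q1; exists w => /=.
      by apply: sub_val_inj; rewrite dE wE /= dy q2 linear0.
    by exists 0; rewrite wE subrr linear0.
- apply: retract_projective P_proj.
  have [|||s sE] := @linear_of_rel _ P (stepX n) (fun q z => sub_val z = (p q, q)).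
  + split; first by rewrite !linear0.
    by move=> a x y v w e e'; rewrite !linearP e e'.
  + move=> q; apply: (@sub_mk _ _ _ (step_submod n) (p q, q)); split=> //=.
    * by move=> _; rewrite gtr_id.
    * by move=> e; lia.
  + move=> y; rewrite !linear0 => e; apply: sub_val_inj; by rewrite e linear0.
  exists (snd \o @sub_val _ _ _ (step_submod n)), s => z; apply: sub_val_inj.
  rewrite sE /= [RHS]surjective_pairing; congr pair.
  by have [<- // _ _] := sub_valP z; rewrite gtr_id.
- move=> m mn m1n.
  have [|||s sE] := @linear_of_rel _ (X m) (stepX m) (fun x z => sub_val z = (x, 0)).
  + split; first by rewrite !linear0.
    by move=> a x y v w e e'; rewrite linearP e e'; congr pair; rewrite /= scaler0 addr0.
  + by move=> x; apply: (@sub_mk _ _ _ (step_submod m) (x, 0)); split.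
  + move=> y e; apply: sub_val_inj; by rewrite e linear0.
  exists (fst \o @sub_val _ _ _ (step_submod m)), s => z; apply: sub_val_inj.
  rewrite sE /= [RHS]surjective_pairing; congr pair.
  by have [_ _ ->] := sub_valP z.
Qed.

End Step.

(** The step is applied in degrees [b], [b - 1], ..., [a + 1]; the last one makes
    the lowest module, in degree [a], a syzygy.                               *)
Lemma resolution X (b a : int) : (forall n, b < n -> trivial_mod (X n)) ->
  (forall n, n < a -> trivial_mod (X n)) -> a <= b ->
  exists (R : cpx A) (r : cmap R X),
    [/\ qis r, proj_above a R, forall n, b < n -> trivial_mod (R n)
      & forall n, n < a -> trivial_mod (R n)].
Proof.
move=> Xb Xa ab.
have main (j : nat) : a <= b - j%:Z -> exists (R : cpx A) (r : cmap R X),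
    [/\ qis r, proj_above (b - j%:Z) R, forall n, b < n -> trivial_mod (R n)
      & forall n, n < a -> trivial_mod (R n)].
  elim: j => [|j IH] aj.
    exists X, (cid X); split=> //; first exact: qis_id.
    by move=> n bn; apply: trivial_projective; apply: Xb; lia.
  have [|R [r [qr Rp Rb Ra]]] := IH; first by lia.
  have [m [p ps]] := fin_gen_cover (cobj_fg R (b - j%:Z)).
  have [R' [r' [qr' R'n R'm]]] := resolution_step (@free_projective _ m) (@free_fin_gen _ m) ps.
  exists R', (ccomp r r'); split; first exact: qis_comp.
  - move=> n jn; have [->//|/eqP ne] := eqVneq n (b - j%:Z).
    by apply: retract_projective (R'm n _ _) (Rp n _); lia.
  - by move=> n bn; apply: retract_trivial (R'm n _ _) (Rb n _); lia.
  - by move=> n na; apply: retract_trivial (R'm n _ _) (Ra n _); lia.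
have [|R [r [qr Rp Rb Ra]]] := main `|b - a|%N; first by lia.
by exists R, r; split=> // n an; apply: Rp; lia.
Qed.

Lemma resolution_ex X (a : int) :
  exists (R : cpx A) (r : cmap R X), qis r /\ proj_above a R.
Proof.
have [N XN] := cobj_bounded X.
have [||| R [r [qr Rp _ _]]] := @resolution X N%:Z (Num.min a (- N%:Z)).
- by move=> n Nn; apply: XN; lia.
- by move=> n Nn; apply: XN; lia.
- by lia.
by exists R, r; split=> // n an; apply: Rp; lia.
Qed.

End Resolution.

(** * Finite dimensionality *)

Lemma vspace_of_pred (k : fieldType) (V : vectType k) (S : V -> Prop) :
  S 0 -> (forall a x y, S x -> S y -> S (a *: x + y)) ->
  exists U : {vspace V}, forall v, v \in U <-> S v.
Proof.
move=> S0 SP.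
pose Q d := `[< exists U : {vspace V}, \dim U = d /\ forall v, v \in U -> S v >].
have Q0 : exists d, Q d.
  exists 0%N; apply/asboolP; exists 0%VS; rewrite dimv0; split=> // v.
  by rewrite memv0 => /eqP ->.
have Qle d : Q d -> (d <= \dim {:V})%N.
  by move=> /asboolP[U [<- _]]; apply/dimvS/subvf.
case: (ex_maxnP Q0 Qle) => d /asboolP[U [Ud US]] dmax.
exists U => v; split=> [|Sv]; first exact: US.
apply: contraT => vU.
have: (\dim (U + <[v]>) <= d)%N.
  apply: dmax; apply/asboolP; exists (U + <[v]>)%VS; split=> // w.
  move=> /memv_addP[u uU [_ /vlineP[a ->] ->]].
  by rewrite addrC; apply: SP => //; apply: US.
rewrite -Ud (geq_leqif (dimv_leqif_sup (addvSl U <[v]>))) => sub.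
by rewrite -(negPf vU); apply: (subvP sub); rewrite memvE addvSr.
Qed.

Section FiniteDimensional.
Variables (k : fieldType) (A : kalgebra k).

Definition kscale (M : lmodType A) (a : k) (x : M) : M := kalg_unit A a *: x.

Definition klinear (M : lmodType A) (V : lmodType k) (f : M -> V) : Prop :=
  forall a x y, f (kscale a x + y) = a *: f x + f y.

(** By Zorn's lemma, for the graph [S] of a functional defined on a subspace.  No
    dimension is assumed finite, since injectivity is tested on arbitrary
    modules.                                                                  *)
Lemma functional_extension (M : lmodType A) (S : M -> k -> Prop) :
  S 0 0 ->
  (forall a x y c d, S x c -> S y d -> S (kscale a x + y) (a * c + d)) ->
  (forall c, S 0 c -> c = 0) ->
  exists f : M -> k, klinear (f : M -> k^o) /\ forall x c, S x c -> f x = c.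
Proof.
move=> S0 SP Sfun.
pose r (X : set (M * k)) x c := S x c \/ X (x, c).
pose P (X : set (M * k)) := (forall a x y c d, r X x c -> r X y d ->
   r X (kscale a x + y) (a * c + d)) /\ (forall c, r X 0 c -> c = 0).
have [F FP Ftot|X [[XP Xfun] Xmax]] := @Zorn_bigcup (M * k)%type P.
  split=> [a x y c d|c [/Sfun//|[X FX Xc]]]; last first.
    by apply: (FP X FX).2; right.
  have up X x0 c0 : F X -> r X x0 c0 -> r (\bigcup_(X in F) X)%classic x0 c0.
    by move=> FX [Sx|Xx]; [left|right; exists X].
  move=> [Sx|[X FX Xx]] [Sy|[Y FY Yy]].
  - by left; apply: SP.
  - by apply: (up Y) => //; apply: (FP Y FY).1; [left|right].
  - by apply: (up X) => //; apply: (FP X FX).1; [right|left].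
  - case: (Ftot X Y FX FY) => XY.
    + by apply: (up Y) => //; apply: (FP Y FY).1; right => //; apply: XY.
    + by apply: (up X) => //; apply: (FP X FX).1; right => //; apply: XY.
have r0 : r X 0 0 by left.
have tot x : exists c, r X x c.
  apply: contrapT => nx.
  pose Y : set (M * k) := fun z => exists a y, z.1 = kscale a x + y /\ r X y z.2.
  have rY y c : r X y c -> Y (y, c).
    by move=> ryc; exists 0, y; rewrite /kscale rmorph0 scale0r add0r.
  have rYE y c : r Y y c -> Y (y, c).
    by move=> [Sy|//]; apply: rY; left.
  apply: (Xmax Y).
    split=> [[y c] Xyc|YX]; first by apply: rY; right.
    apply: nx; exists 0; right; apply: YX; exists 1, 0.
    by rewrite /= /kscale rmorph1 scale1r addr0.
  split=> [a y z c d /rYE[b [y' [/= -> ry]]] /rYE[b' [z' [/= -> rz]]]|c /rYE].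
    right; exists (a * b + b'), (kscale a y' + z') => /=; split; last exact: XP.
    rewrite /kscale scalerDr scalerA addrACA -scalerDl.
    by rewrite rmorphD rmorphM.
  move=> [b [y [/= e ry]]]; have [b0|b0] := eqVneq b 0.
    move: e; rewrite b0 /kscale rmorph0 scale0r add0r => e.
    by apply: Xfun; rewrite e.
  case: nx; exists (- b^-1 * c + 0).
  suff -> : x = kscale (- b^-1) y + 0 by apply: XP.
  move/eqP: e; rewrite eq_sym addr_eq0 => /eqP e.
  rewrite addr0 -[y]opprK -e /kscale scalerN scalerA -rmorphM mulNr mulVf //.
  by rewrite rmorphN1 scaleN1r opprK.
have /choice[f fP] := tot.
have funX x c d : r X x c -> r X x d -> c = d.
  move=> xc xd; apply/eqP; rewrite -subr_eq0; apply/eqP/Xfun.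
  have := XP (-1) _ _ _ _ xd xc.
  by rewrite /kscale rmorphN1 scaleN1r addNr mulN1r addrC.
exists f; split=> [a x y|x c Sx]; first by apply: funX (fP _) _; apply: XP.
by apply: funX (fP x) _; left.
Qed.

Hypothesis fdA : finite_dimensional A.

(** A finitely generated module is spanned over [k] by the products of its
    generators with a basis of [A]; [s] takes values in a complement of the
    relations between these products.                                         *)
Lemma fd_coordinates (M : lmodType A) : fin_gen M ->
  exists (V : vectType k) (s : M -> V) (p : V -> M),
    [/\ forall x, p (s x) = x, klinear s
      & forall a u v, p (a *: u + v) = kscale a (p u) + p v].
Proof.
move=> [m [g gP]]; have [n [b bP]] := fdA.
pose V : vectType k := 'M[k]_(m, n).
pose p (u : V) : M := \sum_i \sum_j (kalg_unit A (u i j) * b j) *: g i.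
have pP a u v : p (a *: u + v) = kscale a (p u) + p v.
  rewrite /p /kscale scaler_sumr -big_split; apply: eq_bigr => i _ /=.
  rewrite scaler_sumr -big_split; apply: eq_bigr => j _ /=.
  by rewrite !mxE rmorphD rmorphM mulrDl scalerDl scalerA mulrA.
have p0 : p 0 = 0.
  by rewrite /p big1 // => i _; rewrite big1 // => j _; rewrite mxE rmorph0 mul0r scale0r.
have ps x : exists u, p u = x.
  have [c ->] := gP x.
  have /choice[e eP] := fun i => bP (c i).
  exists (\matrix_(i, j) e i j); apply: eq_bigr => i _; rewrite eP scaler_suml.
  by apply: eq_bigr => j _; rewrite mxE.
have [||K KP] := @vspace_of_pred k V (fun u => p u = 0); first exact: p0.
  by move=> a u v eu ev; rewrite pP eu ev /kscale scaler0 addr0.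
have /choice[s sP] : forall x, exists u, (u \in K^C)%VS /\ p u = x.
  move=> x; have [u <-] := ps x.
  have : u \in (K + K^C)%VS by rewrite addv_complf memvf.
  move=> /memv_addP[w wK [v vK ->]]; exists v; split=> //.
  by rewrite -[w]scale1r pP (KP w).1 // /kscale scaler0 add0r.
exists V, s, p; split=> //; first by move=> x; have [] := sP x.
move=> a x y; apply/eqP; rewrite -subr_eq0 -memv0 -(capv_compl K) memv_cap.
have [sx px] := sP x; have [sy py] := sP y; have [sz pz] := sP (kscale a x + y).
apply/andP; split; last by rewrite memvB // memvD // memvZ.
apply/KP; rewrite addrC -scaleN1r pP pP pz px py.
by rewrite /kscale rmorphN1 scaleN1r addNr.
Qed.

(** The measure for inductions along submodules. *)
Lemma submod_dim (M : lmodType A) : fin_gen M ->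
  exists (N : nat) (d : (M -> Prop) -> nat),
    (forall S, (d S <= N)%N) /\
    (forall S S', submod S -> submod S' -> (forall x, S x -> S' x) ->
       (exists x, S' x /\ ~ S x) -> (d S < d S')%N).
Proof.
move=> /fd_coordinates[V [s [p [ps sP pP]]]].
pose im S (U : {vspace V}) := forall v, v \in U <-> exists x, S x /\ s x = v.
pose sp (S : M -> Prop) : {vspace V} :=
  if pselect (exists U, im S U) is left e then sval (constructive_indefinite_description e) else 0%VS.
have spP S : submod S -> im S (sp S).
  move=> [S0 SP]; rewrite /sp; case: pselect => [e|[]]; first exact: svalP (constructive_indefinite_description e).
  apply: vspace_of_pred.
    exists 0; split=> //; have := sP (-1) 0 0.
    by rewrite /kscale scaler0 addr0 scaleN1r addNr.
  move=> a _ _ [x [Sx <-]] [y [Sy <-]]; exists (kscale a x + y).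
  by split; [apply: SP|rewrite sP].
exists (\dim {:V}), (fun S => \dim (sp S)); split=> [S|S S' hS hS' SS' [x [S'x Sx]]].
  exact/dimvS/subvf.
have sub : (sp S <= sp S')%VS.
  apply/subvP => v /(spP _ hS)[y [Sy <-]]; apply/(spP _ hS').
  by exists y; split=> //; apply: SS'.
rewrite ltn_neqAle dimvS // andbT; apply/negP => /eqP e.
have /eqP E : sp S == sp S' by rewrite eqEdim sub e /=.
case: Sx; have : s x \in sp S by rewrite E; apply/(spP _ hS'); exists x.
by move=> /(spP _ hS)[y [Sy /(congr1 p)]]; rewrite !ps => <-.
Qed.

Lemma fd_noetherian : noetherian A.
Proof.
move=> M S hS /fd_coordinates[V [s [p [ps sP pP]]]].
have [||U UP] := @vspace_of_pred k V (fun v => exists x, S x /\ s x = v).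
- exists 0; split; first by case: hS.
  by have := sP (-1) 0 0; rewrite /kscale scaler0 addr0 scaleN1r addNr.
- move=> a _ _ [x [Sx <-]] [y [Sy <-]]; exists (kscale a x + y).
  by split; [apply: hS.2|rewrite sP].
have p0 : p 0 = 0 by have := pP (-1) 0 0; rewrite /kscale scaler0 addr0 rmorphN1 scaleN1r addNr.
have psum n (c : 'I_n -> k) w :
    p (\sum_i c i *: w i) = \sum_i kscale (c i) (p (w i)).
  by apply: (big_rec2 (fun x y => p y = x)) => // i x y _ <-; rewrite pP.
have /choice[g gP] : forall i : 'I_(\dim U), exists y : sub_mod hS, sub_val y = p (vbasis U)`_i.
  move=> i; apply: sub_mk.
  have /UP[x [Sx <-]] : (vbasis U)`_i \in U by apply: vbasis_mem; apply: memt_nth.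
  by rewrite ps.
exists (\dim U), g => x.
have /coord_vbasis E : s (sub_val x) \in U by apply/UP; exists (sub_val x); split=> //; apply: sub_valP.
exists (fun i => kalg_unit A (coord (vbasis U) i (s (sub_val x)))).
apply: sub_val_inj; rewrite -[LHS]ps [in LHS]E linear_sum.
rewrite psum; apply: eq_bigr => i _; by rewrite linearZ -gP.
Qed.

(** The [T j] are the factors of a chain of left ideals with simple quotients.
    If [U] is the first ideal of the chain with [U z <> 0], then the map
    [u |-> u z] embeds the simple factor at [U] into [Z].                     *)
Lemma composition_factors : exists (r : nat) (T : nat -> lmodType A),
  (forall j, fin_gen (T j)) /\
  forall (Z : lmodType A) (z : Z), z <> 0 ->
    exists (j : nat) (i : {linear T j -> Z}),
      [/\ (j < r)%N, injective i & exists t, i t <> 0].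
Proof.
have [N [d [_ dlt]]] := submod_dim (regular_fin_gen A).
suff main n (S : A^o -> Prop) : submod S -> (d S < n)%N ->
    exists (r : nat) (T : nat -> lmodType A),
    (forall j, fin_gen (T j)) /\
    forall (Z : lmodType A) (z : Z), (exists u, S u /\ (u : A) *: z <> 0) ->
    exists (j : nat) (i : {linear T j -> Z}),
      [/\ (j < r)%N, injective i & exists t, i t <> 0].
  have hT : submod (fun _ : A^o => True) by split.
  have [r [T [fgT TP]]] := main _ _ hT (ltnSn _).
  exists r, T; split=> // Z z z0; apply: (TP Z z).
  by exists 1; rewrite scale1r.
elim: n S => [//|n IH] S hS dS.
have [[x0 [Sx0 x00]]|S0] := pselect (exists x, S x /\ x <> 0); last first.
  exists 0%N, (fun _ => A^o); split=> [_|Z z]; first exact: regular_fin_gen.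
  move=> [u [Su uz]].
  by case: S0; exists u; split=> // u0; case: uz; rewrite u0 scale0r.
(* a maximal proper submodule S' of S gives the top factor S / S' *)
pose proper S' := [/\ submod S', forall x, S' x -> S x & exists x, S x /\ ~ S' x].
pose Q m := `[< exists S', proper S' /\ d S' = m >].
have Q0 : exists m, Q m.
  exists (d (fun x => x = 0)); apply/asboolP; exists (fun x => x = 0); split=> //.
  split=> [|x ->|]; last by exists x0.
    by split=> // a x y -> ->; rewrite scaler0 addr0.
  by case: hS.
have Qle m : Q m -> (m <= d S)%N.
  by move=> /asboolP[S' [[hS' S'S ex] <-]]; apply/ltnW/dlt.
case: (ex_maxnP Q0 Qle) => m /asboolP[S' [[hS' S'S ex] dS']] mmax.
have [|r [T [fgT TP]]] := IH S' hS'.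
  exact: leq_trans (dlt _ _ hS' hS S'S ex) dS.
have hS1 : submod (fun x : sub_mod hS => S' (sub_val x)).
  split; first by rewrite linear0; case: hS'.
  by move=> a x y S'x S'y; rewrite linearP; apply: hS'.2.
have [Tr [q [qs qK]]] := quot_exists hS1.
have fgTr : fin_gen Tr.
  by apply: (fin_gen_img _ qs); apply: fd_noetherian; exact: regular_fin_gen.
exists r.+1, (fun j => if (j < r)%N then T j else Tr); split=> [j|Z z]; first by case: ifP.
move=> [u [Su uz]]; have [/TP[j [i [jr iinj it]]]|S'z] := pselect (exists u, S' u /\ (u : A) *: z <> 0).
  by exists j; rewrite jr; exists i; split=> //; apply: ltnW.
have {}S'z v : S' v -> (v : A) *: z = 0.
  by move=> S'v; apply: contrapT => vz; apply: S'z; exists v.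
exists r; rewrite ltnn.
have [|||i iP] := @linear_of_rel A Tr Z (fun t y => exists x, q x = t /\ y = (sub_val x : A) *: z).
- split; first by exists 0; rewrite !linear0 scale0r.
  move=> a x y v w [x' [<- ->]] [y' [<- ->]]; exists (a *: x' + y').
  by rewrite !linearP scalerDl scalerA.
- by move=> t; have [x <-] := qs t; exists ((sub_val x : A) *: z), x.
- by move=> y [x [/qK S'x ->]]; apply: S'z.
exists i; split=> //; last first.
  have [x xE] := sub_mk hS Su; exists (q x).
  have [x' [e ->]] := iP (q x); move=> x'z; apply: uz.
  have /qK/S'z : q (x - x') = 0 by rewrite linearB e subrr.
  by rewrite linearB xE scalerBl x'z subr0.
apply: raddf_inj => t it; have [x [e ix]] := iP t; rewrite it in ix.
rewrite -e; apply/qK; apply: contrapT => nS'x.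
pose S2 v := S v /\ (v : A) *: z = 0.
have hS2 : submod S2.
  split; first by split; [exact: hS.1|rewrite scale0r].
  move=> a v w [Sv vz] [Sw wz]; split; first exact: hS.2.
  by rewrite scalerDl -[a *: v]/(a * v) -scalerA vz wz scaler0 addr0.
have S2S' : (d S' < d S2)%N.
  apply: dlt => //; first by move=> v S'v; split; [apply: S'S|apply: S'z].
  by exists (sub_val x); split=> //; split=> //; apply: sub_valP.
suff : (d S2 <= m)%N by rewrite -dS' leqNgt S2S'.
apply: mmax; apply/asboolP; exists S2; split=> //; split=> //; first by move=> v [].
by exists u; split=> // -[].
Qed.

(** A nonzero quotient of [Z] contains some [T j], and the quotient by it is a
    smaller quotient of [Z]: a property that is stable under extensions and
    holds for the [T j] holds for all finitely generated modules.             *)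
Lemma devissage : exists (r : nat) (T : nat -> lmodType A),
  (forall j, fin_gen (T j)) /\
  forall V : lmodType A -> Prop,
    (forall Z, trivial_mod Z -> V Z) -> (forall j, (j < r)%N -> V (T j)) ->
    (forall (Z' Z Q : lmodType A) (i : {linear Z' -> Z}) (p : {linear Z -> Q}),
       injective i -> (forall q, exists z, p z = q) ->
       (forall z, p z = 0 <-> exists t, z = i t) -> V Z' -> V Q -> V Z) ->
    forall Z, fin_gen Z -> V Z.
Proof.
have [r [T [fgT TP]]] := composition_factors.
exists r, T; split=> // V V0 VT Vext Z fgZ.
have [N [d [dN dlt]]] := submod_dim fgZ.
suff main n (S : Z -> Prop) (Q : lmodType A) (p : {linear Z -> Q}) :
    submod S -> (N - d S < n)%N -> (forall q, exists z, p z = q) ->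
    (forall z, p z = 0 <-> S z) -> V Q.
  apply: (main _ (fun z => z = 0) Z idfun _ (ltnSn _)) => //.
    by split=> // a x y -> ->; rewrite scaler0 addr0.
  by move=> q; exists q.
elim: n S Q p => [//|n IH] S Q p hS dS ps pS.
have [[z z0]|Q0] := pselect (exists z : Q, z <> 0); last first.
  by apply: V0 => q; apply: contrapT => q0; apply: Q0; exists q.
have [j [i [jr iinj [t it]]]] := TP Q z z0.
have hI : submod (fun q => exists t, q = i t).
  split; first by exists 0; rewrite linear0.
  by move=> a _ _ [x ->] [y ->]; exists (a *: x + y); rewrite linearP.
have [Q' [p' [p's p'K]]] := quot_exists hI.
apply: (Vext _ _ _ i p') => //; first exact: VT.
have hS' : submod (fun z => p' (p z) = 0).
  split; first by rewrite !linear0.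
  by move=> a x y e e'; rewrite !linearP e e' scaler0 addr0.
apply: (IH _ _ (p' \o p) hS') => //=; last first.
  by move=> q; have [q1 <-] := p's q; have [q2 <-] := ps q1; exists q2.
pose S' z := p' (p z) = 0; rewrite -/S' in hS' *.
suff : (d S < d S')%N by have := dN S'; rewrite /S'; lia.
apply: dlt => //; first by move=> x /pS px; rewrite /S' px linear0.
have [x xE] := ps (i t); exists x; split; first by rewrite /S' xE; apply/p'K; exists t.
by move=> /pS; rewrite xE.
Qed.

End FiniteDimensional.

(** * Objects of finite projective or injective dimension *)

Section Vanishing.
Variables (k : fieldType) (A : kalgebra k).
Implicit Types X Y Z W R C : cpx A.

Lemma deq_comp0l X Y Z (f : dexpr X Y) :
  deq (dcomp (dmap (czero Y Z)) f) (dmap (czero X Z)).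
Proof.
apply: deq_trans (deq_comp (deq_sym (deq_addN (dmap (czero Y Z)))) (deq_refl f)) _.
apply: deq_trans (deq_compDl _ _ _) _.
apply: deq_trans (deq_add (deq_compZl _ _ _) (deq_refl _)) _.
exact: deq_addN.
Qed.

Lemma deq_comp0r X Y Z (f : dexpr Y Z) :
  deq (dcomp f (dmap (czero X Y))) (dmap (czero X Z)).
Proof.
apply: deq_trans (deq_comp (deq_refl f) (deq_sym (deq_addN (dmap (czero X Y))))) _.
apply: deq_trans (deq_compDr _ _ _) _.
apply: deq_trans (deq_add (deq_compZr _ _ _) (deq_refl _)) _.
exact: deq_addN.
Qed.

Definition dzero X Y (f : dexpr X Y) : Prop := deq f (dmap (czero X Y)).

Lemma dzero_compl X Y Z (g : dexpr Y Z) (f : dexpr X Y) : dzero f -> dzero (dcomp g f).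
Proof. move=> f0; exact: deq_trans (deq_comp (deq_refl g) f0) (deq_comp0r _ _). Qed.

Lemma dzero_compr X Y Z (g : dexpr Y Z) (f : dexpr X Y) : dzero g -> dzero (dcomp g f).
Proof. move=> g0; exact: deq_trans (deq_comp g0 (deq_refl f)) (deq_comp0l _ _). Qed.

Lemma dzero_deq X Y (f g : dexpr X Y) : deq f g -> dzero g -> dzero f.
Proof. exact: deq_trans. Qed.

Lemma dzero_diso_l X Y Z (a : dexpr Y Z) (f : dexpr X Y) :
  diso a -> dzero (dcomp a f) -> dzero f.
Proof.
move=> [b [ba _]] /(dzero_compl b); apply: dzero_deq.
apply: deq_trans (deq_sym (deq_comp1l f)) _.
apply: deq_trans (deq_sym (deq_compA _ _ _)).
by apply: deq_comp; [exact: deq_sym|exact: deq_refl].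
Qed.

Lemma dzero_diso_r X Y Z (a : dexpr X Y) (f : dexpr Y Z) :
  diso a -> dzero (dcomp f a) -> dzero f.
Proof.
move=> [b [_ ab]] /(dzero_compr b); apply: dzero_deq.
apply: deq_trans (deq_sym (deq_comp1r f)) _.
apply: deq_trans (deq_compA _ _ _).
by apply: deq_comp; [exact: deq_refl|exact: deq_sym].
Qed.

Lemma diso_sym X Y (a : dexpr X Y) : diso a -> exists b : dexpr Y X, diso b.
Proof. by move=> [b [ba ab]]; exists b; exists a. Qed.

Lemma diso_comp X Y Z (b : dexpr Y Z) (a : dexpr X Y) :
  diso b -> diso a -> diso (dcomp b a).
Proof.
move=> [b' [b'b bb']] [a' [a'a aa']]; exists (dcomp a' b'); split.
- apply: deq_trans (deq_sym (deq_compA _ _ _)) _.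
  apply: deq_trans (deq_comp (deq_refl _) (deq_compA _ _ _)) _.
  apply: deq_trans (deq_comp (deq_refl _) (deq_comp b'b (deq_refl _))) _.
  exact: deq_trans (deq_comp (deq_refl _) (deq_comp1l _)) a'a.
- apply: deq_trans (deq_sym (deq_compA _ _ _)) _.
  apply: deq_trans (deq_comp (deq_refl _) (deq_compA _ _ _)) _.
  apply: deq_trans (deq_comp (deq_refl _) (deq_comp aa' (deq_refl _))) _.
  exact: deq_trans (deq_comp (deq_refl _) (deq_comp1l _)) bb'.
Qed.

Lemma qis_diso X Y (s : cmap X Y) (qs : qis s) : diso (dmap s).
Proof. by exists (dinv qs); split; [apply: deq_invl|apply: deq_invr]. Qed.

Lemma diso_shift X Y (a : dexpr X Y) : diso a -> diso (dshift a).
Proof.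
move=> [b [ba ab]]; exists (dshift b).
split; [apply: deq_trans (deq_shift ba) _|apply: deq_trans (deq_shift ab) _];
  by apply/deq_map/cmap_eq_homotopic.
Qed.

Definition isomorphic X Y : Prop := exists a : dexpr X Y, diso a.

Lemma isomorphic_shiftn X Y i : isomorphic X Y -> isomorphic (shiftn i X) (shiftn i Y).
Proof.
move=> XY; elim: i => [//|i [a ai]]; exists (dshift a); exact: diso_shift.
Qed.

Definition no_hom X Y : Prop := forall f : dexpr X Y, dzero f.

Lemma no_hom_isomorphic X X' Y Y' :
  isomorphic X X' -> isomorphic Y Y' -> no_hom X Y -> no_hom X' Y'.
Proof.
move=> [a ai] [b /diso_sym[b' bi']] XY f.
exact: dzero_diso_l bi' (dzero_diso_r ai (XY _)).
Qed.

Lemma isomorphic_refl X : isomorphic X X.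
Proof. by exists (did X), (did X); split; apply: deq_comp1l. Qed.

Lemma isomorphic_sym X Y : isomorphic X Y -> isomorphic Y X.
Proof. by move=> [a /diso_sym]. Qed.

Lemma isomorphic_trans X Y Z : isomorphic X Y -> isomorphic Y Z -> isomorphic X Z.
Proof. by move=> [a ai] [b bi]; exists (dcomp b a); apply: diso_comp. Qed.

Lemma qis_isomorphic X Y (s : cmap X Y) : qis s -> isomorphic X Y.
Proof. by move=> qs; exists (dmap s); apply: qis_diso. Qed.

Definition ev_no_hom X Y : Prop :=
  exists N : nat, forall i : nat, (N <= i)%N -> no_hom X (shiftn i Y).

Definition finite_projdim_obj X : Prop := forall Y, ev_no_hom X Y.
Definition finite_injdim_obj Y : Prop := forall X, ev_no_hom X Y.

Lemma ev_no_hom_isomorphic X X' Y Y' :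
  isomorphic X X' -> isomorphic Y Y' -> ev_no_hom X Y -> ev_no_hom X' Y'.
Proof.
move=> XX YY [N NP]; exists N => i Ni.
apply: no_hom_isomorphic (NP i Ni) => //; exact: isomorphic_shiftn.
Qed.

Lemma finite_projdim_isomorphic X X' :
  isomorphic X X' -> finite_projdim_obj X -> finite_projdim_obj X'.
Proof. by move=> e h Y; apply: ev_no_hom_isomorphic (h Y) => //; apply: isomorphic_refl. Qed.

Lemma finite_injdim_isomorphic Y Y' :
  isomorphic Y Y' -> finite_injdim_obj Y -> finite_injdim_obj Y'.
Proof. by move=> e h X; apply: ev_no_hom_isomorphic (h X) => //; apply: isomorphic_refl. Qed.

Definition projdim_to_injdim : Prop :=
  forall X, finite_projdim_obj X -> finite_injdim_obj X.
Definition injdim_to_projdim : Prop :=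
  forall X, finite_injdim_obj X -> finite_projdim_obj X.

End Vanishing.

Section Transfer.
Variables (k : fieldType) (A B : kalgebra k) (F : triangle_functor B A).
Hypotheses (hF : eventually_homological_iso F) (hsurj : essentially_surjective F).

Lemma functor_dzero (X Y : cpx B) (f : dexpr X Y) : dzero f -> dzero (tmap F f).
Proof.
have F0 : dzero (tmap F (dmap (czero X Y))).
  apply: deq_trans (tmap_deq F (deq_sym (deq_addN (dmap (czero X Y))))) _.
  apply: deq_trans (tmap_add _ _ _) _.
  apply: deq_trans (deq_add (tmap_scale _ _ _) (deq_refl _)) _.
  exact: deq_addN.
by move=> f0; apply: deq_trans (tmap_deq F f0) F0.
Qed.

(** Vanishing of morphisms to high shifts is reflected by injectivity of the maps
    on morphisms, and preserved by their surjectivity.                        *)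
Lemma functor_ev_no_hom (Y Z : cpx B) : ev_no_hom (F Y) (F Z) <-> ev_no_hom Y Z.
Proof.
have [N NP] := hF Y Z; split=> -[M MP]; exists (maxn M N) => i;
  rewrite geq_max => /andP[Mi /NP[inj surj]] f.
- have ind0 (g : dexpr Y (shiftn i Z)) : dzero g -> dzero (induced_map F g).
    by move=> g0; apply: dzero_compl; apply: functor_dzero.
  apply: inj; apply: deq_trans (MP i Mi _) _.
  exact/deq_sym/ind0/deq_refl.
- have [g gf] := surj f; apply: dzero_deq (deq_sym gf) _.
  by apply: dzero_compl; apply: functor_dzero; apply: MP.
Qed.

Lemma functor_finite_projdim (Y : cpx B) :
  finite_projdim_obj (F Y) <-> finite_projdim_obj Y.
Proof.
split=> h Z; first exact/functor_ev_no_hom.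
have [W [a ai]] := hsurj Z.
by apply: (ev_no_hom_isomorphic (isomorphic_refl _) (ex_intro _ a ai)); apply/functor_ev_no_hom.
Qed.

Lemma functor_finite_injdim (Y : cpx B) :
  finite_injdim_obj (F Y) <-> finite_injdim_obj Y.
Proof.
split=> h Z; first exact/functor_ev_no_hom.
have [W [a ai]] := hsurj Z.
by apply: (ev_no_hom_isomorphic (ex_intro _ a ai) (isomorphic_refl _)); apply/functor_ev_no_hom.
Qed.

Lemma functor_projdim_to_injdim : projdim_to_injdim A <-> projdim_to_injdim B.
Proof.
split=> h X; first by move=> /functor_finite_projdim/h/functor_finite_injdim.
have [Y [a ai]] := hsurj X; have e := ex_intro _ a ai.
move=> /(finite_projdim_isomorphic (isomorphic_sym e))/functor_finite_projdim/h.
by move=> /functor_finite_injdim; apply: finite_injdim_isomorphic.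
Qed.

Lemma functor_injdim_to_projdim : injdim_to_projdim A <-> injdim_to_projdim B.
Proof.
split=> h X; first by move=> /functor_finite_injdim/h/functor_finite_projdim.
have [Y [a ai]] := hsurj X; have e := ex_intro _ a ai.
move=> /(finite_injdim_isomorphic (isomorphic_sym e))/functor_finite_injdim/h.
by move=> /functor_finite_projdim; apply: finite_projdim_isomorphic.
Qed.

End Transfer.

Section ProjectiveComplexes.
Variables (k : fieldType) (A : kalgebra k).
Hypothesis fdA : finite_dimensional A.
Implicit Types X Y Z W R C : cpx A.

(** Vanishing in the derived category gives a homotopy only after restriction
    along a further resolution [R' -> R], from which the homotopy descends.   *)
Lemma dzero_null_homotopic R Y (q : cmap R Y) (a : int) :
  proj_above a R -> (forall n, n < a -> trivial_mod (Y n)) ->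
  dzero (dmap q) -> homotopic q (czero R Y).
Proof.
move=> Rp Y0 /deval_deq[b bP].
have [R' [r [qr R'p]]] := resolution_ex (fd_noetherian fdA) R b.
apply: null_homotopic_desc qr Rp Y0 _.
apply: homotopic_trans (bP R' R'p r) _.
by apply: cmap_eq_homotopic.
Qed.

(** Stated up to isomorphism, because the shifts of a complex in degree [0] have
    their module in degrees such as [- i + 1 + ... + 1].                      *)
Definition concentrated Y (m : int) (M : lmodType A) : Prop :=
  (forall n, n <> m -> trivial_mod (Y n)) /\
  exists (i : {linear M -> Y m}) (p : {linear Y m -> M}),
    (forall x, p (i x) = x) /\ (forall y, i (p y) = y).

Lemma stalk_ex (M : lmodType A) : fin_gen M -> exists Y, concentrated Y 0 M.
Proof.
move=> fgM; pose S (n : int) (x : M) := n <> 0 -> x = 0.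
have hS n : submod (S n).
  by split=> // a x y Sx Sy n0; rewrite Sx // Sy // scaler0 addr0.
have T0 n : n <> 0 -> trivial_mod (sub_mod (hS n)).
  by move=> n0 x; apply: sub_val_inj; rewrite linear0; apply: (sub_valP x).
have fg n : fin_gen (sub_mod (hS n)) by apply: fd_noetherian.
have bd : exists N : nat, forall n : int, (N < absz n)%N -> forall x : sub_mod (hS n), x = 0.
  by exists 0%N => n n0; apply: T0; lia.
pose Y := @Cpx k A (fun n => sub_mod (hS n)) (fun n => \0) (fun n x => erefl) fg bd.
exists Y; split; first exact: T0.
have [|||i iP] := @linear_of_rel _ M (sub_mod (hS 0)) (fun x y => sub_val y = x).
- by split=> [|a x y v w e e']; rewrite ?linear0 // linearP e e'.
- by move=> x; apply: sub_mk.
- by move=> y e; apply: sub_val_inj; rewrite e linear0.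
exists i, sub_val; split=> [//|y]; exact: sub_val_inj (iP _).
Qed.

Lemma concentrated_shiftn Y M i :
  concentrated Y 0 M -> concentrated (shiftn i Y) (- i%:Z) M.
Proof.
move=> cY; elim: i => [|i [T0 ex]] /=; first by rewrite oppr0.
split=> [n ni|]; first by apply: T0; lia.
by rewrite /= (_ : - i.+1%:Z + 1 = - i%:Z) //; lia.
Qed.

Lemma concentrated_cmap R Y (n : int) M (i : {linear M -> Y (n + 1)})
    (f : {linear R (n + 1) -> M}) :
  (forall m, m <> n + 1 -> trivial_mod (Y m)) -> (forall x, f (cdiff R n x) = 0) ->
  exists g : cmap R Y, forall x, g (n + 1) x = i (f x).
Proof.
move=> Y0 fd.
pose g := @dfwith _ (fun m => {linear R m -> Y m}) (fun m => \0) (n + 1) (i \o f).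
have gC m x : g (m + 1) (cdiff R m x) = cdiff Y m (g m x).
  have [e|/eqP ne] := eqVneq m n.
    rewrite e in x *; rewrite /g dfwith_in /= fd linear0.
    by rewrite dfwith_out ?linear0 //; lia.
  by apply/trivial_eq/Y0; lia.
by exists (CMap gC) => x; rewrite /= /g dfwith_in.
Qed.

Lemma concentrated_null R Y (n : int) M (i : {linear M -> Y (n + 1)})
    (p : {linear Y (n + 1) -> M}) (f : {linear R (n + 1) -> M}) (g : cmap R Y) :
  (forall x, p (i x) = x) -> trivial_mod (Y n) ->
  (forall x, g (n + 1) x = i (f x)) -> homotopic g (czero R Y) ->
  exists h : {linear R (n + 1 + 1) -> M}, forall x, f x = h (cdiff R (n + 1) x).
Proof.
move=> pi Yn gE [h hP]; exists (p \o h (n + 1)) => x /=.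
have := hP n x; rewrite /= subr0 gE (Yn (h n x)) linear0 add0r => <-.
by rewrite pi.
Qed.

(** In a long enough resolution [Q], the lowest module [Z], a deep syzygy, is a
    summand of the next one, hence projective.  The splitting extends the
    identity of [Z] along the differential.  It exists because morphisms to the
    high shifts of the [T j] of [devissage] vanish, so that every map from [Z]
    to some [T j], and by dévissage to any module, extends.                   *)
Lemma finite_projdim_resolution X (b : int) :
  finite_projdim_obj X -> (forall n, b < n -> trivial_mod (X n)) ->
  exists (Q : cpx A) (q : cmap Q X),
    [/\ qis q, forall n, projective (Q n) & forall n, b < n -> trivial_mod (Q n)].
Proof.
move=> fpX Xb; have [r [T [fgT dev]]] := devissage fdA.
have /choice[Y YP] : forall j, exists Y, concentrated Y 0 (T j).
  by move=> j; apply: stalk_ex.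
have [N0 N0P] : exists N0 : nat, forall j, (j < r)%N -> forall i, (N0 <= i)%N ->
    no_hom X (shiftn i (Y j)).
  elim: r {dev} => [|r [N NP]]; first by exists 0%N.
  have [M MP] := fpX (Y r); exists (maxn M N) => j; rewrite ltnS leq_eqVlt => jr i.
  rewrite geq_max => /andP[Mi Ni].
  by case/orP: jr => [/eqP ->|jr]; [apply: MP|apply: NP].
have [c Xc] := cobj_bounded X.
(* beyond the bound N0 that is common to the T j, and below the support of X *)
pose N := (N0 + c + absz b)%N.
have [n nN] : exists n, n + 1 = - N%:Z by exists (- N%:Z - 1); lia.
have [||| R [q [qq Rp Rb Rn]]] := @resolution _ _ (fd_noetherian fdA) X b (n + 1) => //.
- by move=> m mN; apply: Xc; lia.
- by lia.
have RN : exists h : {linear R (n + 1 + 1) -> R (n + 1)}, forall x, x = h (cdiff R (n + 1) x).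
  suff: forall f : {linear R (n + 1) -> R (n + 1)}, exists h : {linear R (n + 1 + 1) -> R (n + 1)},
      forall x, f x = h (cdiff R (n + 1) x) by move=> /(_ idfun).
  refine (dev (fun V => forall f : {linear R (n + 1) -> V},
    exists h : {linear R (n + 1 + 1) -> V}, forall x, f x = h (cdiff R (n + 1) x))
    _ _ _ (R (n + 1)) (cobj_fg _ _)).
  - by move=> Z Z0 f; exists \0 => x; apply: trivial_eq.
  - move=> j jr f; have [Y0 [i [p [pi _]]]] := concentrated_shiftn N (YP j).
    rewrite -nN in Y0 i p pi.
    have [|g gE] := concentrated_cmap i Y0 (f := f).
      by move=> x; rewrite (Rn n _ x) ?linear0 //; lia.
    apply: (concentrated_null pi _ gE); first by apply: Y0; lia.
    apply: dzero_null_homotopic Rp _ _; first by move=> m mN; apply: Y0; lia.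
    have g0 : dzero (dcomp (dmap g) (dinv qq)) by apply: N0P => //; rewrite /N; lia.
    apply: dzero_deq (dzero_compr (dmap q) g0).
    apply: deq_trans (deq_compA _ _ _); apply: deq_sym.
    by apply: deq_trans (deq_comp (deq_refl _) (deq_invl qq)) (deq_comp1r _).
  - move=> Z' Z Q i p iinj ps pK VZ' VQ f.
    have [h hP] := VQ (p \o f).
    have [|||h' h'P] := Rp (n + 1 + 1) _ Z (fun x z => p z = h x).
    + by lia.
    + by split=> [|a x y v w e e']; rewrite ?linear0 // !linearP e e'.
    + by move=> x; have [z <-] := ps (h x); exists z.
    have [|||f' f'P] := @linear_of_rel _ (R (n + 1)) Z'
        (fun x z => f x - h' (cdiff R (n + 1) x) = i z).
    + split=> [|a x y v w e e']; first by rewrite !(linear0, addr0).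
      by rewrite !linearP /= -e -e' scalerDr addrACA.
    + move=> x; apply/pK; rewrite linearB h'P -hP /=; exact: subrr.
    + by move=> z; rewrite !(linear0, addr0) => e; apply: iinj; rewrite -e linear0.
    have [g gP] := VZ' f'; exists (h' \+ (i \o g)) => x /=.
    by rewrite -gP -f'P -[LHS](subrK (h' (cdiff R (n + 1) x))); exact: addrC.
exists R, q; split=> // m; have [nm|mn] := ltP (n + 1) m; first exact: Rp.
have [->|/eqP ne] := eqVneq m (n + 1); last by apply/trivial_projective/Rn; lia.
have [h hP] := RN; apply: (@retract_projective _ _ (R (n + 1 + 1))); last by apply: Rp; lia.
by exists (cdiff R (n + 1)), h.
Qed.

End ProjectiveComplexes.

(** * Finite self-injective dimension *)

Lemma injective_extension (R : pzRingType) (I V : lmodType R) (S : V -> I -> Prop) :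
  injective_module I -> linrel S -> (forall y, S 0 y -> y = 0) ->
  exists g : {linear V -> I}, forall x y, S x y -> g x = y.
Proof.
move=> injI [S0 SP] Sfun.
have hD : submod (fun x => exists y, S x y).
  split; first by exists 0.
  by move=> a x y [v xv] [w yw]; exists (a *: v + w); apply: SP.
have uniqS x y z : S x y -> S x z -> y = z.
  move=> xy xz; apply/eqP; rewrite -subr_eq0; apply/eqP/Sfun.
  by have := SP (-1) _ _ _ _ xz xy; rewrite !scaleN1r addNr addrC.
have [|||f fP] := @linear_of_rel _ (sub_mod hD) I (fun x y => S (sub_val x) y).
- split; first by rewrite linear0.
  by move=> a x y v w xv yw; rewrite linearP; apply: SP.
- by move=> x; exact: (sub_valP x).
- by move=> y; rewrite linear0; apply: Sfun.
have [g gP] := injI _ _ (@sub_val _ _ _ hD) f sub_val_inj.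
exists g => x y xy; have [x' xE] := sub_mk hD (ex_intro _ y xy).
by rewrite -xE gP; apply: uniqS (fP x') _; rewrite xE.
Qed.

Section SelfInjective.
Variables (k : fieldType) (A : kalgebra k).
Implicit Types X Y Z W R C Q : cpx A.

(** By injectivity of [I j] and exactness of [R], a cocycle with values in
    [ker (d j)] extends to a map to [I j].  What prevents the extension from
    having values in [ker (d j)] is a cocycle with values in [ker (d j.+1)], one
    degree further, which is a coboundary by induction; a lift of it corrects
    the extension.                                                            *)
Lemma dimension_shift (n0 : nat) (I : nat -> lmodType A)
    (d : forall j, {linear I j -> I j.+1}) R (a m0 : int) :
  (forall j, injective_module (I j)) ->
  (forall j, (n0 < j)%N -> trivial_mod (I j)) ->
  (forall j x, d j.+1 x = 0 <-> exists y, x = d j y) ->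
  proj_above a R ->
  (forall (m : int) x, m <= m0 -> cdiff R (m + 1) x = 0 -> exists y, x = cdiff R m y) ->
  forall (t j : nat) (m : int) (f : {linear R (m + 1) -> I j}),
    (j + t = n0.+1)%N -> a <= m -> m + t%:Z <= m0 ->
    (forall x, d j (f x) = 0) -> (forall x, f (cdiff R m x) = 0) ->
    exists h : {linear R (m + 1 + 1) -> I j},
      (forall x, d j (h x) = 0) /\ forall x, f x = h (cdiff R (m + 1) x).
Proof.
move=> injI I0 dex Rp Rex; elim=> [|t IH] j m f.
  move=> jn _ _ _ _; exists \0.
  by split=> x; [rewrite linear0|apply/trivial_eq/I0; lia].
move=> jt am mm df fd.
have [||g gP] := @injective_extension _ (I j) (R (m + 1 + 1))
    (fun y v => exists x, y = cdiff R (m + 1) x /\ v = f x) (injI j).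
- split; first by exists 0; rewrite !linear0.
  by move=> c y y' _ _ [x [-> ->]] [x' [-> ->]]; exists (c *: x + x'); rewrite !linearP.
- move=> _ [x [/esym dx ->]]; have [|y ->] := Rex _ x _ dx; [lia|exact: fd].
have {}gP x : g (cdiff R (m + 1) x) = f x by apply: gP; exists x.
have [||||| u [du uP]] := IH j.+1 (m + 1) (d j \o g).
- by rewrite addSn -addnS.
- by lia.
- by lia.
- by move=> x; apply/dex; exists (g x).
- by move=> x; rewrite /= gP.
have [|||v vP] := Rp (m + 1 + 1 + 1) _ (I j) (fun x w => d j w = u x).
- by lia.
- by split=> [|c x y w w' e e']; rewrite ?linear0 // !linearP e e'.
- by move=> x; have /dex[y ->] := du x; exists y.
exists (g \- (v \o cdiff R (m + 1 + 1))); split=> x /=.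
  by rewrite linearB vP -uP subrr.
by rewrite gP cdiffK linear0 subr0.
Qed.

(** [A] is the kernel of [I 0 -> I 1]; finitely generated projectives are treated
    as summands of free modules, one coordinate at a time.                    *)
Lemma coboundary_projective : finite_left_injdim A -> exists n0 : nat,
  forall R (a m0 : int), proj_above a R ->
  (forall (m : int) x, m <= m0 -> cdiff R (m + 1) x = 0 -> exists y, x = cdiff R m y) ->
  forall P : lmodType A, projective P -> fin_gen P ->
  forall (m : int) (f : {linear R (m + 1) -> P}), a <= m -> m + n0%:Z <= m0 ->
    (forall x, f (cdiff R m x) = 0) ->
    exists h : {linear R (m + 1 + 1) -> P}, forall x, f x = h (cdiff R (m + 1) x).
Proof.
move=> [n0 [I [e [d [injI I0 einj e0 dex]]]]]; exists n0.+1.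
move=> R a m0 Rp Rex P Pp Pfg m f am mm fd.
have dimA (p : {linear R (m + 1) -> A^o}) : (forall x, p (cdiff R m x) = 0) ->
    exists h : {linear R (m + 1 + 1) -> A^o}, forall x, p x = h (cdiff R (m + 1) x).
  move=> pd.
  have [||h [dh hP]] := dimension_shift injI I0 dex Rp Rex (f := e \o p) (add0n _) am mm.
  - by move=> x; apply/e0; exists (p x).
  - by move=> x; rewrite /= pd linear0.
  have [|||q qP] := @linear_of_rel _ (R (m + 1 + 1)) A^o (fun x y => h x = e y).
  - by split=> [|c x y v w E E']; rewrite ?linear0 // !linearP E E'.
  - by move=> x; apply/e0.
  - by move=> y; rewrite linear0 => /esym E; apply: einj; rewrite E linear0.
  by exists q => x; apply: einj; rewrite -qP -hP.
have [l [p ps]] := fin_gen_cover Pfg.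
have [|s sP] := Pp _ (fun x v => p v = x) _ ps.
  by split=> [|c x y v w E E']; rewrite ?linear0 // !linearP E E'.
have /choice[h hP] : forall j, exists h : {linear R (m + 1 + 1) -> A^o},
    forall x, (s (f x) 0 j : A^o) = h (cdiff R (m + 1) x).
  move=> j; have [|c cE] := @linear_of_fun _ (R (m + 1)) A^o (fun x => s (f x) 0 j).
    by move=> c x y; rewrite !linearP !mxE.
  have [|h hP] := dimA c; first by move=> x; rewrite cE fd linear0 mxE.
  by exists h => x; rewrite -hP cE.
have [|g gE] := @linear_of_fun _ (R (m + 1 + 1)) (free_mod A l) (fun x => \row_j h j x).
  by move=> c x y; apply/rowP => j; rewrite !mxE linearP.
exists (p \o g) => x /=; rewrite -[LHS]sP; congr (p _).
by rewrite gE; apply/rowP => j; rewrite mxE hP.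
Qed.

Lemma shiftn_all (P : lmodType A -> Prop) X i :
  (forall n, P (X n)) -> forall n, P (shiftn i X n).
Proof. by move=> PX; elim: i => [|i IH] n //=; apply: IH. Qed.

Lemma shiftn_above X (b : int) i : (forall n, b < n -> trivial_mod (X n)) ->
  forall n, b - i%:Z < n -> trivial_mod (shiftn i X n).
Proof.
by move=> Xb; elim: i => [|i IH] n bn; [apply: Xb; lia|apply: IH; lia].
Qed.

Lemma shiftn_below X (b : int) i : (forall n, n < b -> trivial_mod (X n)) ->
  forall n, n < b - i%:Z -> trivial_mod (shiftn i X n).
Proof.
by move=> Xb; elim: i => [|i IH] n bn; [apply: Xb; lia|apply: IH; lia].
Qed.

Hypothesis fdA : finite_dimensional A.

(** For large [i], the shift [Q[i]] lives in degrees where a resolution of [X] is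
    exact, so that chain maps from the resolution to [Q[i]] are null-homotopic. *)
Lemma projective_finite_injdim Q : finite_left_injdim A ->
  (forall n, projective (Q n)) -> finite_injdim_obj Q.
Proof.
move=> /coboundary_projective[n0 ext] Qp X.
have [c Xc] := cobj_bounded X; have [c' Qc] := cobj_bounded Q.
exists (c + c' + n0 + 5)%N => i ii f.
have Q1 : forall n, c'%:Z - i%:Z < n -> trivial_mod (shiftn i Q n).
  by apply: shiftn_above => n nc; apply: Qc; lia.
have Q2 : forall n, n < - c'%:Z - i%:Z -> trivial_mod (shiftn i Q n).
  by apply: shiftn_below => n nc; apply: Qc; lia.
(* a is below the support of Q[i] *)
have [a0 a0P] := deval_okP f; pose a := Num.min a0 (- c'%:Z - i%:Z - 5).
have [R [r [qr Rp]]] := resolution_ex (fd_noetherian fdA) X a.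
have ok : deval_ok R f by apply: a0P => n an; apply: Rp; rewrite /a; lia.
have Rex (m : int) x : m <= - c%:Z - 2 -> cdiff R (m + 1) x = 0 -> exists y, x = cdiff R m y.
  move=> mc dx; have [inj _] := qr m; apply: (inj x dx).
  by exists 0; rewrite linear0; apply: Xc; lia.
apply: dzero_diso_r (qis_diso qr) _; apply: dzero_deq (deval_sound r ok) _.
apply/deq_map/null_homotopic_ext => n p pd.
have [n1|n1] := ltP (c'%:Z - i%:Z) (n + 1).
  by exists \0 => x; apply/trivial_eq/Q1.
have [n2|n2] := ltP (n + 1) (- c'%:Z - i%:Z).
  by exists \0 => x; apply/trivial_eq/Q2.
apply: (ext R a _ Rp Rex) => //; last 1 first.
- by rewrite /a; lia.
- exact: shiftn_all.
- exact: cobj_fg.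
- by rewrite /a; lia.
Qed.

Lemma left_injdim_projdim_to_injdim : finite_left_injdim A -> projdim_to_injdim A.
Proof.
move=> injA X fpX; have [c Xc] := cobj_bounded X.
have [|Q [q [qq Qp _]]] := finite_projdim_resolution fdA fpX (b := c%:Z).
  by move=> n cn; apply: Xc; lia.
apply: finite_injdim_isomorphic (qis_isomorphic qq) _.
exact: projective_finite_injdim.
Qed.

End SelfInjective.

(** * Duality *)

(** Two algebras [A] and [B] that are opposite to each other are kept apart,
    since the opposite of the opposite of [A] is not convertible to [A].      *)
Record antimorphism (k : fieldType) (A B : kalgebra k) := Antimorphism {
  anti_fun :> B -> A;
  antiD : forall x y, anti_fun (x + y) = anti_fun x + anti_fun y;
  antiM : forall x y, anti_fun (x * y) = anti_fun y * anti_fun x;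
  anti1 : anti_fun 1 = 1;
  anti_unit : forall a, anti_fun (kalg_unit B a) = kalg_unit A a }.

Section DualModule.
Variables (k : fieldType) (A B : kalgebra k) (t : antimorphism A B).

(** The antimorphism is a parameter of the type in order to determine the
    [B]-module structure.                                                     *)
Record kdual (u : antimorphism A B) (M : lmodType A) : Type :=
  KDual { kdual_fun :> M -> k; kdualP : klinear (kdual_fun : M -> k^o) }.

Notation "M ^*" := (kdual t M) : type_scope.

HB.instance Definition _ M := gen_eqMixin (M^*)%type.
HB.instance Definition _ M := gen_choiceMixin (M^*)%type.

Section OneModule.
Variable M : lmodType A.
Implicit Types f g : M^*.

Lemma kdual_eq f g : (forall x, f x = g x) -> f = g.
Proof.
case: f g => [f fP] [g gP] /= /funext fg; subst g.
by rewrite (Prop_irrelevance fP gP).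
Qed.

Lemma kdual_linear f a x y : f (kscale a x + y) = a * f x + f y.
Proof. exact: kdualP. Qed.

Lemma kdual0 f : f 0 = 0.
Proof.
have := kdual_linear f (-1) 0 0.
by rewrite /kscale scaler0 addr0 mulN1r addNr.
Qed.

Lemma kdualD f x y : f (x + y) = f x + f y.
Proof. by have := kdual_linear f 1 x y; rewrite /kscale rmorph1 scale1r mul1r. Qed.

Lemma kdualN f x : f (- x) = - f x.
Proof. by apply/eqP; rewrite -addr_eq0 -kdualD addNr kdual0. Qed.

Lemma kdualZ f a x : f (kscale a x) = a * f x.
Proof. by have := kdual_linear f a x 0; rewrite !addr0 kdual0 addr0. Qed.

Fact zero_klinear : klinear ((fun _ => 0) : M -> k^o).
Proof. by move=> a x y; rewrite scaler0 addr0. Qed.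
Fact opp_klinear f : klinear ((fun x => - f x) : M -> k^o).
Proof. by move=> a x y; rewrite kdual_linear opprD scalerN. Qed.
Fact add_klinear f g : klinear ((fun x => f x + g x) : M -> k^o).
Proof. by move=> a x y; rewrite !kdual_linear scalerDr addrACA. Qed.
Fact act_klinear (b : B) f : klinear ((fun x => f (t b *: x)) : M -> k^o).
Proof.
move=> a x y; rewrite -[RHS]kdual_linear; congr (f _).
by rewrite scalerDr /kscale !scalerA kalg_central.
Qed.

Definition kdual_zero : M^* := KDual t zero_klinear.
Definition kdual_opp f : M^* := KDual t (opp_klinear f).
Definition kdual_add f g : M^* := KDual t (add_klinear f g).
Definition kdual_act b f : M^* := KDual t (act_klinear b f).

Fact kdual_addA : associative kdual_add.
Proof. by move=> f g h; apply: kdual_eq => x /=; rewrite addrA. Qed.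
Fact kdual_addC : commutative kdual_add.
Proof. by move=> f g; apply: kdual_eq => x /=; rewrite addrC. Qed.
Fact kdual_add0 : left_id kdual_zero kdual_add.
Proof. by move=> f; apply: kdual_eq => x /=; rewrite add0r. Qed.
Fact kdual_addN : left_inverse kdual_zero kdual_opp kdual_add.
Proof. by move=> f; apply: kdual_eq => x /=; rewrite addNr. Qed.
HB.instance Definition _ :=
  GRing.isZmodule.Build (M^*)%type kdual_addA kdual_addC kdual_add0 kdual_addN.

Fact kdual_actA a b f : kdual_act a (kdual_act b f) = kdual_act (a * b) f.
Proof. by apply: kdual_eq => x /=; rewrite scalerA antiM. Qed.
Fact kdual_act1 : left_id 1 kdual_act.
Proof. by move=> f; apply: kdual_eq => x /=; rewrite anti1 scale1r. Qed.
Fact kdual_actDr : right_distributive kdual_act +%R.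
Proof. by move=> a f g; apply: kdual_eq. Qed.
Fact kdual_actDl f : {morph kdual_act^~ f : a b / a + b}.
Proof. by move=> a b; apply: kdual_eq => x /=; rewrite antiD scalerDl kdualD. Qed.
HB.instance Definition _ := GRing.Zmodule_isLmodule.Build B (M^*)%type
  kdual_actA kdual_act1 kdual_actDr kdual_actDl.

Lemma kdual_addE f g x : (f + g) x = f x + g x. Proof. by []. Qed.
Lemma kdual_scaleE b f x : (b *: f) x = f (t b *: x). Proof. by []. Qed.
Lemma kdual_kscaleE a f x : kscale a f x = a * f x.
Proof. by rewrite kdual_scaleE anti_unit -kdualZ. Qed.

Lemma kdual_extension (S : M -> k -> Prop) :
  S 0 0 ->
  (forall a x y c d, S x c -> S y d -> S (kscale a x + y) (a * c + d)) ->
  (forall c, S 0 c -> c = 0) -> exists f : M^*, forall x c, S x c -> f x = c.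
Proof.
move=> S0 SP Sfun; have [f [fl fP]] := functional_extension S0 SP Sfun.
by exists (KDual t fl).
Qed.

Lemma kdual_separates x : (forall f, f x = 0) -> x = 0.
Proof.
move=> fx0; apply: contrapT => x0.
have [|||f fP] := @kdual_extension (fun y c => y = kscale c x).
- by rewrite /kscale rmorph0 scale0r.
- by move=> a _ _ c d -> ->; rewrite /kscale scalerA -rmorphM -scalerDl rmorphD.
- move=> c e; apply/eqP; apply: contraT => c0; case: x0.
  have := congr1 (kscale c^-1) e.
  by rewrite /kscale scaler0 scalerA -rmorphM mulVf // rmorph1 scale1r => <-.
have := fP x 1; rewrite fx0 /kscale rmorph1 scale1r => /(_ erefl) /esym/eqP.
by rewrite oner_eq0.
Qed.

Hypothesis fdA : finite_dimensional A.

Lemma kdual_basis : fin_gen M -> exists (n : nat) (e : 'I_n -> M^*) (y : 'I_n -> M),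
  forall f, f = \sum_i kscale (f (y i)) (e i).
Proof.
move=> /(fd_coordinates fdA)[V [s [p [ps sP pP]]]].
have p0 : p 0 = 0.
  by have := pP (-1) 0 0; rewrite /kscale scaler0 addr0 rmorphN1 scaleN1r addNr.
have /choice[e eP] : forall i, exists f : M^*, forall x, f x = coord (vbasis {:V}) i (s x).
  move=> i; suff h : klinear ((fun x => coord (vbasis {:V}) i (s x)) : M -> k^o).
    by exists (KDual t h).
  by move=> a x y; rewrite sP linearP.
exists _, e, (fun i => p (vbasis {:V})`_i) => f; apply: kdual_eq => x.
have sumE n (F : 'I_n -> M^*) : (\sum_i F i) x = \sum_i F i x.
  by apply: (big_rec2 (fun (u : M^*) v => u x = v)) => // i u v _ <-.
have fpE n (c : 'I_n -> k) w : f (p (\sum_i c i *: w i)) = \sum_i c i * f (p (w i)).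
  apply: (big_rec2 (fun u v => f (p u) = v)) => [|i u v _ <-]; first by rewrite p0 kdual0.
  by rewrite pP kdual_linear.
rewrite sumE -[in LHS](ps x) (coord_vbasis (memvf (s x))) fpE.
by apply: eq_bigr => i _; rewrite kdual_kscaleE eP mulrC.
Qed.

Lemma kdual_fin_gen : fin_gen M -> fin_gen (M^*)%type.
Proof.
move=> /kdual_basis[n [e [y ey]]]; exists n, e => f.
by exists (fun i => kalg_unit B (f (y i))).
Qed.

End OneModule.

Section DualMap.
Variables (M N : lmodType A) (g : {linear M -> N}).

Fact kdual_map_klinear (f : N^*) : klinear ((fun x => f (g x)) : M -> k^o).
Proof. by move=> a x y; rewrite linearP; apply: kdual_linear. Qed.

Definition kdual_map (f : N^*) : M^* := KDual t (kdual_map_klinear f).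

Fact kdual_map_linear : linear kdual_map.
Proof. by move=> b f f'; apply: kdual_eq => x /=; rewrite linearZ. Qed.

HB.instance Definition _ :=
  GRing.isLinear.Build B (N^*)%type (M^*)%type *:%R kdual_map kdual_map_linear.

Lemma kdual_mapE f x : kdual_map f x = f (g x). Proof. by []. Qed.

End DualMap.

End DualModule.
Arguments kdual_map {k A B} t {M N} g _.

Section TotalForms.
Variables (k : fieldType) (A : kalgebra k).
Implicit Types X Y : cpx A.

Lemma gdiff_homotopy X Y (f g : cmap X Y) (h : forall n : int, {linear X (n + 1) -> Y n}) :
  (forall n x, f (n + 1) x - g (n + 1) x = cdiff Y n (h n x) + h (n + 1) (cdiff X (n + 1) x)) ->
  forall p q r, p + 1 = q -> q + 1 = r -> forall x, f q x - g q x =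
    h q (gtr X r (q + 1) (gdiff X q r x)) + gdiff Y p q (h p (gtr X q (p + 1) x)).
Proof. by move=> hP p q r <- <- x; rewrite !gtr_id !gdiffE hP; exact: addrC. Qed.

Lemma gdiff_qis X Y (f : cmap X Y) : qis f ->
  forall p q r, p + 1 = q -> q + 1 = r ->
  (forall x y, gdiff X q r x = 0 -> f q x = gdiff Y p q y -> exists x', x = gdiff X p q x')
  /\ (forall y, gdiff Y q r y = 0 ->
      exists x w, gdiff X q r x = 0 /\ y = f q x + gdiff Y p q w).
Proof.
move=> qf p q r <- <-; have [inj surj] := qf p; split=> [x y|y]; rewrite gdiffE.
  rewrite gdiffE => dx e; have [|x' ->] := inj x dx; first by exists y.
  by exists x'; rewrite gdiffE.
move=> /surj[x dx [w e]]; exists x, w; rewrite !gdiffE; split=> //.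
by rewrite -e; apply/esym; exact: etrans (addrC _ _) (subrK _ _).
Qed.

Lemma gdiff_gtr X m m' n n' : m + 1 = m' -> m = n -> m' = n' -> forall x,
  gdiff X n n' (gtr X m n x) = gtr X m' n' (gdiff X m m' x).
Proof. by move=> <- <- <- x; rewrite !gtr_id. Qed.

Lemma bijective_qis X Y (f : cmap X Y) :
  (forall n, injective (f n)) -> (forall n y, exists x, f n x = y) -> qis f.
Proof.
move=> finj fsurj n; split=> [x _ [y fx]|y dy].
  have [x' e] := fsurj n y; exists x'; apply: finj.
  by rewrite fx cmap_comm e.
have [x e] := fsurj (n + 1) y; exists x.
  by apply: finj; rewrite cmap_comm e dy linear0.
by exists 0; rewrite e subrr linear0.
Qed.

(** The isomorphism is [f n], up to a sign that alternates with [n]. *)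
Lemma sign_isomorphic X Y (f : forall n, {linear X n -> Y n}) :
  (forall n x, f (n + 1) (cdiff X n x) = - cdiff Y n (f n x)) ->
  (forall n, injective (f n)) -> (forall n y, exists x, f n x = y) -> isomorphic X Y.
Proof.
move=> fd finj fsurj; pose s (n : int) : bool := odd (absz n).
have sS n : s (n + 1) = ~~ s n.
  rewrite /s; case: n => n; first by rewrite -PoszD addn1 /=.
  case: n => [|n]; first by [].
  by rewrite (_ : Negz n.+1 + 1 = Negz n) /= ?negbK //; lia.
have /family_choice[g gP] : forall n, exists g : {linear X n -> Y n},
    forall x, g x = if s n then - f n x else f n x.
  by move=> n; case: (s n); [exists (\- f n)|exists (f n)].
have gC n x : g (n + 1) (cdiff X n x) = cdiff Y n (g n x).
  by rewrite !gP sS; case: (s n); rewrite /= fd ?linearN ?opprK.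
apply: (@qis_isomorphic _ _ _ _ (CMap gC)); apply: bijective_qis => n /=.
  by move=> x y; rewrite !gP; case: (s n) => [/oppr_inj|]; apply: finj.
move=> y; have [x e] := fsurj n (if s n then - y else y); exists x; rewrite gP e.
by case: (s n); rewrite ?opprK.
Qed.

End TotalForms.

Section DualComplex.
Variables (k : fieldType) (A B : kalgebra k) (t : antimorphism A B).
Hypothesis fdA : finite_dimensional A.
Implicit Types X Y Z : cpx A.

Notation dual M := (kdual t M).

(** The parameter [c] is there so that a shift of a dual complex is again a dual
    complex, up to the sign of the differential.                              *)
Section Objects.
Variables (c : int) (X : cpx A).

Definition dual_diff (n : int) : {linear dual (X (c - n)) -> dual (X (c - (n + 1)))} :=
  kdual_map t (gdiff X (c - (n + 1)) (c - n)).

Fact dual_diffK (n : int) x : dual_diff (n + 1) (dual_diff n x) = 0.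
Proof. by apply: kdual_eq => y; rewrite !kdual_mapE gdiffK kdual0. Qed.

Fact dual_fin_gen (n : int) : fin_gen (dual (X (c - n))).
Proof. by apply: kdual_fin_gen => //; exact: cobj_fg. Qed.

Fact dual_bounded : exists N : nat, forall n : int, (N < absz n)%N ->
  forall f : dual (X (c - n)), f = 0.
Proof.
have [N XN] := cobj_bounded X; exists (N + absz c)%N => n nN f.
by apply: kdual_eq => x; rewrite (XN _ _ x) ?kdual0 //; lia.
Qed.

Definition dual_cpx : cpx B :=
  @Cpx k B (fun n => dual (X (c - n))) dual_diff dual_diffK dual_fin_gen dual_bounded.

End Objects.

Lemma dual_diffE c X n (f : dual_cpx c X n) (x : X (c - (n + 1))) :
  (cdiff (dual_cpx c X) n f : dual _) x = (f : dual _) (gdiff X (c - (n + 1)) (c - n) x).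
Proof. by []. Qed.

Lemma gdiff_dual c X m n (f : dual_cpx c X m) (x : X (c - n)) : m + 1 = n ->
  (gdiff (dual_cpx c X) m n f : dual _) x = (f : dual _) (gdiff X (c - n) (c - m) x).
Proof. by move=> e; move: x; rewrite -e => x; rewrite gdiffE. Qed.

Section Maps.
Variables (c : int) (X Y : cpx A).

Fact dual_cmap_comm (f : cmap X Y) n (x : dual_cpx c Y n) :
  kdual_map t (f (c - (n + 1))) (cdiff (dual_cpx c Y) n x) =
  cdiff (dual_cpx c X) n (kdual_map t (f (c - n)) x).
Proof. by apply: kdual_eq => y; rewrite !kdual_mapE gdiff_cmap. Qed.

Definition dual_cmap (f : cmap X Y) : cmap (dual_cpx c Y) (dual_cpx c X) :=
  @CMap k B (dual_cpx c Y) (dual_cpx c X) (fun n => kdual_map t (f (c - n)))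
    (dual_cmap_comm f).

Lemma dual_homotopic (f g : cmap X Y) :
  homotopic f g -> homotopic (dual_cmap f) (dual_cmap g).
Proof.
move=> [h hP].
exists (fun n => kdual_map t (h (c - (n + 1)) \o gtr X (c - n) (c - (n + 1) + 1))).
move=> n p; apply: kdual_eq => x /=.
rewrite -kdualD -kdualN -kdualD; congr (p _).
by rewrite (gdiff_homotopy hP (p := c - (n + 1 + 1)) (r := c - n)) //; lia.
Qed.

(** Both halves extend a functional: from boundaries to the whole module for
    injectivity on cohomology, and from the sums of boundaries and images of
    cycles for surjectivity.                                                  *)
Lemma dual_qis (f : cmap X Y) : qis f -> qis (dual_cmap f).
Proof.
move=> qf n; set p := c - (n + 1 + 1); set q := c - (n + 1); set r := c - n.
have [||inj surj] := @gdiff_qis _ _ _ _ f qf p q r; try by rewrite /p /q /r; lia.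
split=> [u du [v uv]|u du].
  have {}du w : (u : dual _) (gdiff Y p q w) = 0.
    by have := congr1 (fun g : dual _ => g w) du.
  have {}uv w : (u : dual _) (f q w) = (v : dual _) (gdiff X q r w).
    by have := congr1 (fun g : dual _ => g w) uv.
  have [|||g gP] := @kdual_extension _ _ _ t (Y r)
      (fun z a => exists y, z = gdiff Y q r y /\ a = (u : dual _) y).
  - by exists 0; rewrite linear0 kdual0.
  - move=> a _ _ _ _ [y [-> ->]] [y' [-> ->]]; exists (kscale a y + y').
    by rewrite kdual_linear linearP.
  - move=> a [y [/esym/surj[x [w [dx ->]]] ->]].
    by rewrite kdualD uv dx kdual0 du addr0.
  by exists g; apply: kdual_eq => y; rewrite dual_diffE (gP _ (u y)) //; exists y.
have {}du w : (u : dual _) (gdiff X p q w) = 0.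
  by have := congr1 (fun g : dual _ => g w) du.
have [|||g gP] := @kdual_extension _ _ _ t (Y q) (fun y a => exists x w,
    [/\ gdiff X q r x = 0, y = f q x + gdiff Y p q w & a = (u : dual _) x]).
- by exists 0, 0; rewrite !linear0 addr0 kdual0.
- move=> a _ _ _ _ [x [w [dx -> ->]]] [x' [w' [dx' -> ->]]].
  exists (kscale a x + x'), (kscale a w + w').
  by rewrite kdual_linear !linearP dx dx' scaler0 addr0 /kscale scalerDr addrACA.
- move=> a [x [w [dx e ->]]].
  have [|x' ->] := inj x (- w) dx; last exact: du.
  by rewrite linearN; apply/eqP; rewrite -addr_eq0 -e.
have [|||v vP] := @kdual_extension _ _ _ t (X r)
    (fun z a => exists x, z = gdiff X q r x /\ a = (u : dual _) x - g (f q x)).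
- by exists 0; rewrite !linear0 !kdual0 subr0.
- move=> a _ _ _ _ [y [-> ->]] [y' [-> ->]]; exists (kscale a y + y').
  rewrite !linearP !kdual_linear; split=> //.
  have E (x z w v : k) : a * (x - z) + (w - v) = a * x + w - (a * z + v).
    by rewrite mulrBr opprD addrACA.
  exact: E.
- move=> a [x [/esym dx ->]]; rewrite (gP (f q x) (u x)) ?subrr //.
  by exists x, 0; rewrite linear0 addr0.
exists g.
  apply: kdual_eq => w; rewrite dual_diffE; apply: gP.
  by exists 0, w; rewrite !linear0 add0r kdual0.
exists v; apply: kdual_eq => x; rewrite dual_diffE.
by apply/esym/vP; exists x.
Qed.

End Maps.

Fixpoint dual_dexpr c X Y (f : dexpr X Y) : dexpr (dual_cpx c Y) (dual_cpx c X) :=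
  match f in dexpr X0 Y0 return dexpr (dual_cpx c Y0) (dual_cpx c X0) with
  | dmap _ _ f => dmap (dual_cmap c f)
  | dinv _ _ s qs => dinv (dual_qis c qs)
  | dcomp _ _ _ g f => dcomp (dual_dexpr c f) (dual_dexpr c g)
  | dadd _ _ f g => dadd (dual_dexpr c f) (dual_dexpr c g)
  | dscale _ _ a f => dscale a (dual_dexpr c f)
  end.

Lemma dual_deq c X Y (f g : dexpr X Y) : deq f g -> deq (dual_dexpr c f) (dual_dexpr c g).
Proof.
elim=> {X Y f g} /=; try by [constructor | move=> *; constructor].
- by move=> X Y f g h _ fg _ gh; apply: deq_trans gh.
- by move=> X Y Z W h g f; apply/deq_sym/deq_compA.
- move=> X Y f; apply: deq_trans (deq_comp1r _).
  by apply: deq_comp; [exact: deq_refl|apply/deq_map/cmap_eq_homotopic => n x; apply: kdual_eq].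
- move=> X Y f; apply: deq_trans (deq_comp1l _).
  by apply: deq_comp (deq_refl _); apply/deq_map/cmap_eq_homotopic => n x; apply: kdual_eq.
- move=> X Y f; apply: deq_trans (deq_add0 _).
  apply: deq_add (deq_refl _); apply/deq_map/cmap_eq_homotopic => n x.
  by apply: kdual_eq => y /=; rewrite kdual0.
- move=> X Y f; apply: deq_trans (deq_addN _) _.
  apply/deq_map/cmap_eq_homotopic => n x.
  by apply: kdual_eq => y /=; rewrite kdual0.
- by move=> X Y f g fg; apply/deq_map/dual_homotopic.
- move=> X Y Z g f; apply: deq_trans (deq_mapM _ _).
  by apply/deq_map/cmap_eq_homotopic => n x; apply: kdual_eq.
- move=> X Y f g; apply: deq_trans (deq_mapD _ _).
  by apply/deq_map/cmap_eq_homotopic => n x; apply: kdual_eq => y /=; rewrite kdualD.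
- move=> X Y a f; apply: deq_trans (deq_mapZ _ _).
  apply/deq_map/cmap_eq_homotopic => n x; apply: kdual_eq => y.
  by rewrite /= /lin_scale /= anti_unit linearZ.
- move=> X Y s qs; apply: deq_trans (deq_invr _) _.
  by apply/deq_map/cmap_eq_homotopic => n x; apply: kdual_eq.
- move=> X Y s qs; apply: deq_trans (deq_invl _) _.
  by apply/deq_map/cmap_eq_homotopic => n x; apply: kdual_eq.
Qed.

Lemma dual_dzero c X Y (f : dexpr X Y) : dzero f -> dzero (dual_dexpr c f).
Proof.
move=> /(dual_deq c) f0; apply: deq_trans f0 _; apply/deq_map/cmap_eq_homotopic => n x.
by apply: kdual_eq => y /=; rewrite kdual0.
Qed.

Lemma dual_shift c X : isomorphic (shift (dual_cpx c X)) (dual_cpx (c - 1) X).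
Proof.
apply: (@sign_isomorphic k B (shift (dual_cpx c X)) (dual_cpx (c - 1) X)
  (fun n => kdual_map t (gtr X (c - 1 - n) (c - (n + 1))))).
- move=> n f; apply: kdual_eq => x /=; congr (- (f : dual _) _).
  by rewrite (gdiff_gtr (m' := c - 1 - n)) //; lia.
- move=> n f g /(congr1 (fun h : dual _ => h : _ -> k)) fg; apply: kdual_eq => x.
  have e : c - (n + 1) = c - 1 - n by lia.
  by have := congr1 (fun h => h (gtr X (c - (n + 1)) (c - 1 - n) x)) fg; rewrite /= gtrK.
- move=> n f; exists (kdual_map t (gtr X (c - (n + 1)) (c - 1 - n)) f).
  by apply: kdual_eq => x /=; rewrite gtrK //; lia.
Qed.

Lemma dual_shiftn c X i : isomorphic (shiftn i (dual_cpx c X)) (dual_cpx (c - i%:Z) X).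
Proof.
elim: i => [|i IH] /=; first by rewrite subr0; apply: isomorphic_refl.
apply: isomorphic_trans (_ : isomorphic _ (shift (dual_cpx (c - i%:Z) X))) _.
  exact: (isomorphic_shiftn 1 IH).
rewrite (_ : c - i.+1%:Z = c - i%:Z - 1); last by lia.
exact: dual_shift.
Qed.

End DualComplex.

Section Biduality.
Variables (k : fieldType) (A B : kalgebra k).
Variables (t : antimorphism A B) (u : antimorphism B A).
Hypothesis tu : cancel u t.
Hypotheses (fdA : finite_dimensional A) (fdB : finite_dimensional B).

Section Module.
Variable M : lmodType A.

Fact bidual_klinear (x : M) : klinear ((fun f : kdual t M => f x) : _ -> k^o).
Proof. by move=> a f g; rewrite kdual_addE kdual_kscaleE. Qed.

Definition bidual (x : M) : kdual u (kdual t M) := KDual u (bidual_klinear x).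

Fact bidual_linear : linear bidual.
Proof.
move=> a x y; apply: kdual_eq => f.
by rewrite -[RHS]/(f (t (u a) *: x) + f y) tu -kdualD.
Qed.

HB.instance Definition _ := GRing.isLinear.Build A M (kdual u (kdual t M))
  *:%R bidual bidual_linear.

Lemma bidual_inj : injective bidual.
Proof.
apply: raddf_inj => x x0; apply: (kdual_separates (t := t)) => f.
exact: (congr1 (fun h : kdual u _ => h f) x0).
Qed.

Lemma bidual_surj : fin_gen M -> forall F, exists x, bidual x = F.
Proof.
move=> /(kdual_basis t fdA)[n [e [y ey]]] F.
exists (\sum_i kscale (F (e i)) (y i)); apply: kdual_eq => f /=.
rewrite [in RHS](ey f).
have FE m (c : 'I_m -> k) g : F (\sum_i kscale (c i) (g i)) = \sum_i c i * F (g i).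
  apply: (big_rec2 (fun v w => F v = w)) => [|i v w _ <-]; first exact: kdual0.
  by rewrite kdual_linear.
have fE m (c : 'I_m -> k) g : f (\sum_i kscale (c i) (g i)) = \sum_i c i * f (g i).
  apply: (big_rec2 (fun v w => f v = w)) => [|i v w _ <-]; first exact: kdual0.
  by rewrite kdual_linear.
by rewrite FE fE; apply: eq_bigr => i _; rewrite mulrC.
Qed.

End Module.

Notation D := (dual_cpx t fdA).
Notation D' := (dual_cpx u fdB).

Fact bidual_cmap_comm c (X : cpx A) n x :
  (@bidual _ \o gtr X (n + 1) (c - (c - (n + 1)))) (cdiff X n x) =
  cdiff (D' c (D c X)) n ((@bidual _ \o gtr X n (c - (c - n))) x).
Proof.
apply: kdual_eq => f.
rewrite -[RHS]/((gdiff (D c X) (c - (n + 1)) (c - n) f : kdual t _)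
  (gtr X n (c - (c - n)) x)) gdiff_dual; last by lia.
by congr ((f : kdual t _) _); rewrite (gdiff_gtr (m' := n + 1)) ?gdiffE //; lia.
Qed.

Definition bidual_cmap c (X : cpx A) : cmap X (D' c (D c X)) :=
  @CMap k A X (D' c (D c X)) (fun n => @bidual _ \o gtr X n (c - (c - n)))
    (@bidual_cmap_comm c X).

Lemma bidual_qis c X : qis (bidual_cmap c X).
Proof.
apply: bijective_qis => n /=.
  move=> x y /bidual_inj e.
  have E : n = c - (c - n) by lia.
  by rewrite -[x](gtrK E) e gtrK.
move=> F; have [|x xE] := @bidual_surj (X (c - (c - n))) _ F; first exact: cobj_fg.
by exists (gtr X (c - (c - n)) n x); rewrite /= gtrK //; lia.
Qed.

Lemma bidual_natural c (X Y : cpx A) (f : dexpr X Y) :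
  deq (dcomp (dmap (bidual_cmap c Y)) f)
      (dcomp (dual_dexpr u fdB c (dual_dexpr t fdA c f)) (dmap (bidual_cmap c X))).
Proof.
have natural (V W : cpx A) (g : cmap V W) :
    deq (dcomp (dmap (bidual_cmap c W)) (dmap g))
      (dcomp (dual_dexpr u fdB c (dual_dexpr t fdA c (dmap g))) (dmap (bidual_cmap c V))).
  apply: deq_trans (deq_sym (deq_mapM _ _)) _; apply: deq_trans (deq_mapM _ _).
  apply/deq_map/cmap_eq_homotopic => n x; apply: kdual_eq => h /=.
  congr ((h : kdual t _) _); have : n = c - (c - n) by lia.
  by move: (c - (c - n)) => m <-; rewrite !gtr_id.
elim: X Y / f => [X Y f|X Y s qs|X Y Z g gP f fP|X Y f fP g gP|X Y a f fP] /=.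
- exact: natural.
- apply: deq_trans (deq_comp (deq_refl _) (_ : deq _ _)); last first.
    apply: deq_trans (deq_comp1r _).
    exact: deq_comp (deq_refl _) (deq_invr qs).
  apply: deq_sym.
  apply: deq_trans (deq_comp (deq_refl _) (deq_compA _ _ _)) _.
  apply: deq_trans (deq_comp (deq_refl _) (deq_comp (natural _ _ s) (deq_refl _))) _.
  apply: deq_trans (deq_comp (deq_refl _) (deq_sym (deq_compA _ _ _))) _.
  apply: deq_trans (deq_compA _ _ _) _.
  apply: deq_trans (deq_comp (deq_invl _) (deq_refl _)) _.
  exact: deq_comp1l.
- apply: deq_trans (deq_compA _ _ _) _.
  apply: deq_trans (deq_comp gP (deq_refl _)) _.
  apply: deq_trans (deq_sym (deq_compA _ _ _)) _.
  apply: deq_trans (deq_comp (deq_refl _) fP) _.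
  exact: deq_compA.
- apply: deq_trans (deq_compDr _ _ _) _.
  apply: deq_trans (deq_add fP gP) _.
  exact/deq_sym/deq_compDl.
- apply: deq_trans (deq_compZr _ _ _) _.
  apply: deq_trans (deq_scale _ fP) _.
  exact/deq_sym/deq_compZl.
Qed.

Lemma dual_faithful c (X Y : cpx A) (f : dexpr X Y) :
  dzero (dual_dexpr t fdA c f) -> dzero f.
Proof.
move=> /(dual_dzero u fdB c) f0.
apply: (dzero_diso_l (qis_diso (bidual_qis c Y))).
by apply: dzero_deq (bidual_natural c f) _; apply: dzero_compr.
Qed.

End Biduality.

(** * Duality exchanges projective and injective dimension *)

Section DualDimensions.
Variables (k : fieldType) (A B : kalgebra k).
Variables (t : antimorphism A B) (u : antimorphism B A).
Hypotheses (tu : cancel u t) (ut : cancel t u).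
Hypotheses (fdA : finite_dimensional A) (fdB : finite_dimensional B).

Notation D := (dual_cpx t fdA).
Notation D' := (dual_cpx u fdB).

(** Dualizing [Z -> D W] gives a map from the bidual of [W], that is, from [W], to
    the dual of [Z].                                                          *)
Lemma no_hom_dual c (W : cpx A) (Z : cpx B) : no_hom W (D' c Z) -> no_hom Z (D c W).
Proof.
move=> WZ g; apply: (dual_faithful ut (fdA := fdB) fdA (c := c)).
exact: (dzero_diso_r (qis_diso (bidual_qis tu fdA fdB c W))).
Qed.

Lemma dual_finite_projdim (X : cpx A) : finite_projdim_obj X -> finite_injdim_obj (D 0 X).
Proof.
move=> fpX Z; have [N NP] := fpX (D' 0 Z); exists N => i Ni.
apply: no_hom_isomorphic (isomorphic_refl _) (isomorphic_sym (dual_shiftn t fdA 0 X i)) _.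
apply: no_hom_dual.
exact: no_hom_isomorphic (isomorphic_refl _) (dual_shiftn u fdB 0 Z i) (NP i Ni).
Qed.

Lemma dual_finite_injdim (X : cpx A) : finite_injdim_obj X -> finite_projdim_obj (D 0 X).
Proof.
move=> fiX Z; pose W := D' 0 Z; have [N NP] := fiX W; exists N => i Ni.
have ZW : isomorphic (D 0 W) Z.
  exact/isomorphic_sym/(qis_isomorphic (bidual_qis ut fdB fdA 0 Z)).
apply: no_hom_isomorphic (isomorphic_refl _) (isomorphic_shiftn i ZW) _.
apply: no_hom_isomorphic (isomorphic_refl _) (isomorphic_sym (dual_shiftn t fdA 0 W i)) _.
apply: no_hom_dual.
apply: no_hom_isomorphic (isomorphic_refl _) (dual_shiftn u fdB 0 (D 0 X) i) _.
apply: no_hom_isomorphic (isomorphic_refl _) _ (NP i Ni); apply: isomorphic_shiftn.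
exact: (qis_isomorphic (bidual_qis tu fdA fdB 0 X)).
Qed.

(** A map into the dual of [P] amounts to finitely many functionals, its values
    on the generators [g j] of [P], and these extend.                         *)
Lemma kdual_injective (P : lmodType B) :
  projective P -> fin_gen P -> injective_module (kdual u P).
Proof.
move=> Pp /fin_gen_cover[m [p ps]] M N i f iinj.
have [|s sP] := Pp _ (fun x v => p v = x) _ ps.
  by split=> [|c x y v w e e']; rewrite ?linear0 // !linearP e e'.
pose g j := p (delta_mx 0 j).
have gP x : x = \sum_j (s x 0 j : B) *: g j.
  rewrite -[LHS]sP {1}(row_sum_delta (s x)) linear_sum.
  by apply: eq_bigr => j _; rewrite linearZ.
have /choice[l lP] : forall j, exists h : N -> k, klinear (h : N -> k^o) /\
    forall y, h (i y) = (f y : kdual u P) (g j).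
  move=> j; have [|||h [hl hP]] := @functional_extension k A N
      (fun z c => exists y, z = i y /\ c = (f y : kdual u P) (g j)).
  - by exists 0; rewrite !linear0.
  - move=> a _ _ _ _ [y [-> ->]] [y' [-> ->]]; exists (kscale a y + y').
    by rewrite !linearP kdual_addE kdual_kscaleE.
  - move=> c [y [e ->]]; have -> : y = 0 by apply: iinj; rewrite -e linear0.
    by rewrite linear0.
  by exists h; split=> // y; apply: hP; exists y.
have sumE (h : kdual u P) n (w : 'I_n -> P) : h (\sum_j w j) = \sum_j h (w j).
  by apply: (big_rec2 (fun v w => h v = w)) => [|j v w' _ <-]; rewrite ?kdual0 ?kdualD.
have GP z : klinear ((fun x => \sum_j l j (t (s x 0 j) *: z)) : P -> k^o).
  move=> a x y; rewrite scaler_sumr -big_split; apply: eq_bigr => j _ /=.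
  rewrite -(lP j).1; congr (l j _).
  rewrite linearP !mxE antiD antiM anti_unit scalerDl; congr (_ + _).
  by rewrite /kscale scalerA kalg_central.
have [|G GE] := @linear_of_fun A N (kdual u P) (fun z => KDual u (GP z)).
  move=> a z z'; apply: kdual_eq => x.
  rewrite kdual_addE kdual_scaleE /= -big_split; apply: eq_bigr => j _ /=.
  rewrite linearZ mxE antiM tu scalerDr !scalerA -[_ *: z in LHS]scale1r.
  by rewrite -(rmorph1 (kalg_unit A)) (lP j).1 scale1r.
exists G => y; rewrite GE; apply: kdual_eq => x /=.
rewrite {2}(gP x) sumE; apply: eq_bigr => j _.
rewrite -linearZ (lP j).2 linearZ.
by rewrite -[LHS]/((f y : kdual u P) (u (t (s x 0 j)) *: g j)) ut.
Qed.

End DualDimensions.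

(** * Injective dimension of the algebra *)

Section Opposite.
Variables (k : fieldType) (A : kalgebra k).

Definition opp_unit (a : k) : A^c := kalg_unit A a.

Fact opp_unit_zmod : zmod_morphism opp_unit.
Proof. by move=> a b; apply: (rmorphB (kalg_unit A)). Qed.

Fact opp_unit_monoid : monoid_morphism opp_unit.
Proof.
split; first exact: (rmorph1 (kalg_unit A)).
by move=> a b; rewrite mulrC; apply: (rmorphM (kalg_unit A)).
Qed.

HB.instance Definition _ := GRing.isZmodMorphism.Build k A^c opp_unit opp_unit_zmod.
HB.instance Definition _ := GRing.isMonoidMorphism.Build k A^c opp_unit opp_unit_monoid.

Fact opp_central (a : k) (x : A^c) : opp_unit a * x = x * opp_unit a.
Proof. exact: (esym (kalg_central _ _)). Qed.

Definition opp_alg : kalgebra k := @KAlgebra k A^c opp_unit opp_central.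

Lemma opp_finite_dimensional : finite_dimensional A -> finite_dimensional opp_alg.
Proof.
move=> [n [b bP]]; exists n, b => x; have [c cP] := bP x; exists c.
by apply: etrans cP _; apply: eq_bigr => i _; exact: (@kalg_central k A (c i) (b i)).
Qed.

Definition to_opp : antimorphism A opp_alg :=
  @Antimorphism k A opp_alg (fun x => x) (fun x y => erefl) (fun x y => erefl)
    erefl (fun a => erefl).

Definition of_opp : antimorphism opp_alg A :=
  @Antimorphism k opp_alg A (fun x => x) (fun x y => erefl) (fun x y => erefl)
    erefl (fun a => erefl).

Hypothesis fdA : finite_dimensional A.
Let fdA' := opp_finite_dimensional fdA.

Lemma opp_projdim_to_injdim : projdim_to_injdim opp_alg <-> injdim_to_projdim A.
Proof.
have c1 : cancel to_opp of_opp by [].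
have c2 : cancel of_opp to_opp by [].
split=> h X.
  move=> /(dual_finite_injdim (t := to_opp) (u := of_opp) c2 c1 fdA fdA')/h.
  move=> /(dual_finite_injdim (t := of_opp) (u := to_opp) c1 c2 fdA' fdA).
  apply/finite_projdim_isomorphic/isomorphic_sym.
  exact: (qis_isomorphic (bidual_qis c2 fdA fdA' 0 X)).
move=> /(dual_finite_projdim (t := of_opp) (u := to_opp) c1 c2 fdA' fdA)/h.
move=> /(dual_finite_projdim (t := to_opp) (u := of_opp) c2 c1 fdA fdA').
apply/finite_injdim_isomorphic/isomorphic_sym.
exact: (qis_isomorphic (bidual_qis c1 fdA' fdA 0 X)).
Qed.

Lemma regular_projective : projective (A^o : lmodType A).
Proof.
move=> V S [S0 SP] tot; have [v Sv] := tot 1.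
have [|g gE] := @linear_of_fun A A^o V (fun x => (x : A) *: v).
  by move=> a x y; rewrite scalerDl scalerA.
exists g => x; rewrite gE; have := SP x _ _ _ _ Sv S0.
by have e : (x : A) *: (1 : A^o) = x := mulr1 _; rewrite !addr0 e.
Qed.

(** A projective module is its own resolution, and [Y[i]] vanishes in degree [0]
    for large [i].                                                            *)
Lemma stalk_finite_projdim (S : cpx A) (M : lmodType A) :
  concentrated S 0 M -> projective M -> finite_projdim_obj S.
Proof.
move=> [S0 [i [p [pi ip]]]] Mp Y.
have [N YN] := cobj_bounded Y; exists N.+1 => j jN f.
have Sp a : proj_above a S.
  move=> n _; have [->|/eqP n0] := eqVneq n 0; last exact/trivial_projective/S0.
  by apply: retract_projective Mp; exists p, i.
have [a /(_ S (Sp a)) ok] := deval_okP f.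
apply: deq_trans (deq_sym (deq_comp1r f)) _.
apply: deq_trans (deval_sound (cid S) ok) _.
apply/deq_map/cmap_eq_homotopic => n x.
have [e|/eqP n0] := eqVneq n 0; last by rewrite (S0 n n0 x) !linear0.
apply/trivial_eq/(@shiftn_above _ _ _ N%:Z); last by lia.
by move=> m Nm; apply: YN; lia.
Qed.

(** The dual of [A] has finite projective dimension, hence a resolution [Q] by
    finitely many projectives over the opposite algebra, in degrees [<= 0].  The
    complex [J], the dual of [Q], is the injective resolution of [A].         *)
Lemma projdim_to_injdim_left_injdim : projdim_to_injdim A -> finite_left_injdim A.
Proof.
have c1 : cancel to_opp of_opp by [].
have c2 : cancel of_opp to_opp by [].
move=> h; have [S cS] := stalk_ex fdA (regular_fin_gen A).
have := h _ (stalk_finite_projdim cS regular_projective).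
move=> /(dual_finite_injdim (t := to_opp) (u := of_opp) c2 c1 fdA fdA').
have [S0 [i [p [pi ip]]]] := cS.
move=> /(finite_projdim_resolution fdA')-/(_ 0)[|Q [q [qq Qp Q0]]].
  by move=> n n0 f; apply: kdual_eq => x; rewrite (S0 (0 - n) _ x) ?kdual0 //; lia.
pose J := dual_cpx of_opp fdA' 0 Q.
pose E : cmap S J := ccomp (dual_cmap of_opp fdA' 0 q) (bidual_cmap c2 fdA fdA' 0 S).
have qE : qis E by apply: qis_comp; [apply: dual_qis|apply: bidual_qis].
have [N JN] := cobj_bounded J.
have Jm1 : trivial_mod (J (-1)).
  by move=> f; apply: kdual_eq => x; rewrite (Q0 (0 - (-1)) _ x) ?kdual0 //; lia.
have ES := gdiff_qis qE.
exists N, (fun j => J j%:Z), (E 0 \o i), (fun j => gdiff J j%:Z j.+1%:Z); split.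
- by move=> j; apply: (kdual_injective (t := to_opp) c2 c1) => //; exact: cobj_fg.
- by move=> j Nj; apply: JN; lia.
- apply: raddf_inj => x Ex.
  have [||inj _] := ES (-1) 0 1; [by []|by []|].
  have [||z e] := inj (i x) 0.
  + by apply/trivial_eq/S0.
  + by rewrite linear0; exact: Ex.
  by rewrite -(pi x) e (S0 (-1) _ z) // !linear0.
- move=> x; split=> [dx|[y ->]]; last first.
    by rewrite -[LHS](gdiff_cmap E 1 (i y)) (S0 1 _ (gdiff _ _ _ _)) // linear0.
  have [||_ surj] := ES (-1) 0 1; [by []|by []|].
  have [z [w [_ ->]]] := surj x dx; exists (p z).
  by rewrite (Jm1 w) linear0 addr0 -{1}(ip z).
- move=> j x; split=> [dx|[y ->]]; last exact: gdiffK.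
  have [||_ surj] := ES j%:Z j.+1%:Z j.+2%:Z; [by lia|by lia|].
  have [z [w [_ ->]]] := surj x dx; exists w.
  by rewrite (S0 _ _ z) ?linear0 ?add0r.
Qed.

End Opposite.

Lemma left_injdim_iff (k : fieldType) (A : kalgebra k) : finite_dimensional A ->
  finite_left_injdim A <-> projdim_to_injdim A.
Proof.
move=> fdA; split; first exact: left_injdim_projdim_to_injdim.
exact: projdim_to_injdim_left_injdim.
Qed.

Lemma right_injdim_iff (k : fieldType) (A : kalgebra k) : finite_dimensional A ->
  finite_right_injdim A <-> injdim_to_projdim A.
Proof.
move=> fdA; apply: iff_trans (opp_projdim_to_injdim fdA).
exact: left_injdim_iff (opp_finite_dimensional fdA).
Qed.

Theorem theorem3 (k : fieldType) (A B : kalgebra k)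
    (hA : finite_dimensional A) (hB : finite_dimensional B)
    (F : triangle_functor B A)
    (hF : eventually_homological_iso F) (hsurj : essentially_surjective F) :
  (gorenstein A <-> gorenstein B) /\
  (gorenstein_symmetry A <-> gorenstein_symmetry B).
Proof.
have left : finite_left_injdim A <-> finite_left_injdim B.
  apply: iff_trans (left_injdim_iff hA) _; apply: iff_trans (iff_sym (left_injdim_iff hB)).
  exact: functor_projdim_to_injdim hF hsurj.
have right : finite_right_injdim A <-> finite_right_injdim B.
  apply: iff_trans (right_injdim_iff hA) _; apply: iff_trans (iff_sym (right_injdim_iff hB)).
  exact: functor_injdim_to_projdim hF hsurj.
by rewrite /gorenstein /gorenstein_symmetry; split; tauto.
Qed.
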